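(* Let $\Omega\subset\mathbb{R}^2$ be compact with non-empty interior. For every $h>0$, every solid angle center of $\Omega$ of height $h$ belongs to the minimal unfolded region $uf(\Omega)$.
   Context: For a compact $\Omega\subset\mathbb{R}^2$ with non-empty interior, $h>0$ and $x\in\mathbb{R}^2$, $A_\Omega^{(h)}(x)=\int_\Omega \frac{h}{(|y-x|^2+h^2)^{3/2}}\,dy$. A point $x$ is a solid angle center of $\Omega$ of height $h$ if it maximizes $A_\Omega^{(h)}$ over $\mathbb{R}^2$. Minimal unfolded region: for a unit vector $v\in S^1$ and $c\in\mathbb{R}$, let $I_{v,c}$ be the reflection of $\mathbb{R}^2$ in the line $\{z: z\cdot v=c\}$; let $\Omega^+_{v,a}=\Omega\cap\{z: z\cdot v\ge a\}$ and $\Omega^-_{v,a}=\Omega\cap\{z: z\cdot v\le a\}$. Put $u(v)=\inf\{b\in\mathbb{R}: I_{v,c}(\Omega^+_{v,c})\subset\Omega \text{ for all } c\ge b\}$ and $l(v)=\sup\{b\in\mathbb{R}: I_{v,c}(\Omega^-_{v,c})\subset\Omega \text{ for all } c\le b\}$. Then $uf(\Omega)=\bigcap_{v\in S^1}\{z\in\mathbb{R}^2: l(v)\le z\cdot v\le u(v)\}$. *)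

(* Defs.v *)
From Stdlib Require Import Reals Lra List Classical ClassicalEpsilon.
Open Scope R_scope.

Definition pt := (R * R)%type.
Definition dot (a b : pt) : R := fst a * fst b + snd a * snd b.
Definition dist2 (a b : pt) : R :=
  (fst a - fst b) ^ 2 + (snd a - snd b) ^ 2.

Definition open2 (U : pt -> Prop) : Prop :=
  forall z, U z -> exists r, 0 < r /\ forall w, dist2 w z < r ^ 2 -> U w.

Definition compact2 (Om : pt -> Prop) : Prop :=
  forall (I : Type) (U : I -> pt -> Prop),
    (forall i, open2 (U i)) ->
    (forall z, Om z -> exists i, U i z) ->
    exists l : list I, forall z, Om z -> exists i, In i l /\ U i z.

Definition nonempty_interior (Om : pt -> Prop) : Prop :=
  exists z r, 0 < r /\ forall w, dist2 w z < r ^ 2 -> Om w.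

(* Rsup E = least upper bound of E if E is non-empty and bounded above,
   and 0 otherwise (in particular Rsup of the empty set is 0). *)
Definition Rsup (E : R -> Prop) : R :=
  match excluded_middle_informative (bound E /\ exists x, E x) with
  | left H => proj1_sig (completeness E (proj1 H) (proj2 H))
  | right _ => 0
  end.
Definition Rinf (E : R -> Prop) : R := - Rsup (fun x => E (- x)).

Definition fsum (K : nat) (f : nat -> R) : R :=
  fold_right Rplus 0 (map f (seq 0 K)).

(* Upper dyadic Darboux sum at level n of F * 1_Om on the box [-N,N]^2,
   using the half-open squares
   [-N + i/2^n, -N + (i+1)/2^n) x [-N + j/2^n, -N + (j+1)/2^n). *)
Definition upper_sum (Om : pt -> Prop) (F : pt -> R) (n N : nat) : R :=
  let d := / 2 ^ n in
  let K := (2 * N * 2 ^ n)%nat in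
  fsum K (fun i => fsum K (fun j =>
    d * d * Rsup (fun s => exists y : pt, Om y /\
        - INR N + INR i * d <= fst y < - INR N + INR (S i) * d /\
        - INR N + INR j * d <= snd y < - INR N + INR (S j) * d /\
        s = F y))).

(* int_Om F : the (upper Darboux) integral of F over Om, i.e. the infimum of
   the upper dyadic sums over boxes containing Om.  For a compact Om and a
   bounded continuous F >= 0 (so that F * 1_Om is upper semicontinuous with
   compact support) this coincides with the Lebesgue integral. *)
Definition integral2 (Om : pt -> Prop) (F : pt -> R) : R :=
  Rinf (fun s => exists n N : nat,
          (forall z, Om z -> - INR N <= fst z <= INR N /\
                             - INR N <= snd z <= INR N) /\
          s = upper_sum Om F n N).

Definition solid_angle (Om : pt -> Prop) (h : R) (x : pt) : R :=
  integral2 Om (fun y => h / Rpower (dist2 y x + h ^ 2) (3 / 2)).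

Definition is_solid_angle_center (Om : pt -> Prop) (h : R) (x : pt) : Prop :=
  forall y : pt, solid_angle Om h y <= solid_angle Om h x.

Definition unit_vec (v : pt) : Prop := fst v ^ 2 + snd v ^ 2 = 1.

(* reflection in the line {z | z . v = c} (v a unit vector) *)
Definition refl (v : pt) (c : R) (z : pt) : pt :=
  (fst z - 2 * (dot z v - c) * fst v, snd z - 2 * (dot z v - c) * snd v).

Definition refl_plus_in (Om : pt -> Prop) (v : pt) (c : R) : Prop :=
  forall z, Om z -> c <= dot z v -> Om (refl v c z).
Definition refl_minus_in (Om : pt -> Prop) (v : pt) (c : R) : Prop :=
  forall z, Om z -> dot z v <= c -> Om (refl v c z).

Definition uval (Om : pt -> Prop) (v : pt) : R :=
  Rinf (fun b => forall c, b <= c -> refl_plus_in Om v c).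
Definition lval (Om : pt -> Prop) (v : pt) : R :=
  Rsup (fun b => forall c, c <= b -> refl_minus_in Om v c).

Definition uf (Om : pt -> Prop) (z : pt) : Prop :=
  forall v, unit_vec v -> lval Om v <= dot z v <= uval Om v.

(* Main.v *)
(* Let [I] be the reflection in the line [z . v = c], where
   [I (Om^+)] is contained in [Om] and [x . v > c]; let [f] be the indicator
   of [Om] and [k], [k'] the kernels centred at [x], [I x], so [k' = k o I].
   Invariance of the integral under [I] gives
     2 (A (I x) - A x) = int (f - f o I) (k' - k),
   whose integrand is nowhere negative.  It is bounded below on some disc when
   a disc of [Om] in [z . v < c] is reflected off [Om], which is impossible if
   [x] is a maximum.  Hence [I] preserves the interior of [Om].  If [x . v]
   exceeded [u v], this would hold for two different values of [c], so the
   interior of [Om] would be invariant under a non-trivial translation,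
   contradicting boundedness.  The bound by [l v] is the one by [u (- v)].

   The integral is handled through Riemann sums over the lattice [2^-n Z^2]:
   [f] is approximated by the Lipschitz cutoffs [max 0 (1 - m dist (z, Om))],
   which inherit the sign condition on the integrand, and reflections factor
   into shears and flips, which act on each row of the lattice by a
   translation up to an error [O (2^-n)]. *)
Require Import Defs.
From Stdlib Require Import Reals Lra Lia ZArith List Classical ClassicalEpsilon.
Open Scope R_scope.

(** * Finite sums *)

Lemma fold_Rplus_init (l : list R) (a : R) :
  fold_right Rplus a l = fold_right Rplus 0 l + a.
Proof. induction l as [|b l IH]; simpl; lra. Qed.

Lemma fsum_S (K : nat) (f : nat -> R) : fsum (S K) f = fsum K f + f K.
Proof.
  unfold fsum. rewrite seq_S, map_app, fold_right_app, fold_Rplus_init.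
  simpl. ring.
Qed.

Lemma fsum_Sl (K : nat) (f : nat -> R) :
  fsum (S K) f = f 0%nat + fsum K (fun i => f (S i)).
Proof.
  induction K as [|K IH].
  - unfold fsum; simpl; ring.
  - rewrite fsum_S, IH, fsum_S. ring.
Qed.

Lemma fsum_le (K : nat) (f g : nat -> R) :
  (forall i, (i < K)%nat -> f i <= g i) -> fsum K f <= fsum K g.
Proof.
  induction K as [|K IH]; intros H.
  - unfold fsum; simpl; lra.
  - rewrite !fsum_S. apply Rplus_le_compat; [apply IH; intros|]; apply H; lia.
Qed.

Lemma fsum_ext (K : nat) (f g : nat -> R) :
  (forall i, (i < K)%nat -> f i = g i) -> fsum K f = fsum K g.
Proof.
  intros H; apply Rle_antisym; apply fsum_le; intros i Hi; rewrite (H i Hi); lra.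
Qed.

Lemma fsum_plus (K : nat) (f g : nat -> R) :
  fsum K (fun i => f i + g i) = fsum K f + fsum K g.
Proof.
  induction K as [|K IH]; [unfold fsum; simpl; ring|].
  rewrite !fsum_S, IH; ring.
Qed.

Lemma fsum_scal (K : nat) (c : R) (f : nat -> R) :
  fsum K (fun i => c * f i) = c * fsum K f.
Proof.
  induction K as [|K IH]; [unfold fsum; simpl; ring|].
  rewrite !fsum_S, IH; ring.
Qed.

Lemma fsum_const (K : nat) (c : R) : fsum K (fun _ => c) = INR K * c.
Proof.
  induction K as [|K IH]; [unfold fsum; simpl; ring|].
  rewrite fsum_S, IH, S_INR; ring.
Qed.

(* The sum of [f] over the integers [- L <= i < L]. *)
Fixpoint ssum (L : nat) (f : Z -> R) : R :=
  match L with
  | O => 0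
  | S L' => ssum L' f + f (Z.of_nat L') + f (- Z.of_nat (S L'))%Z
  end.

Lemma ssum_fsum (L : nat) (f : Z -> R) :
  ssum L f = fsum (2 * L) (fun i => f (Z.of_nat i - Z.of_nat L)%Z).
Proof.
  induction L as [|L IH]; [reflexivity|].
  replace (2 * S L)%nat with (S (S (2 * L))) by lia.
  rewrite fsum_S, fsum_Sl.
  change (ssum (S L) f)
    with (ssum L f + f (Z.of_nat L) + f (- Z.of_nat (S L))%Z).
  rewrite IH.
  replace (Z.of_nat (S (2 * L)) - Z.of_nat (S L))%Z with (Z.of_nat L) by lia.
  replace (Z.of_nat 0 - Z.of_nat (S L))%Z with (- Z.of_nat (S L))%Z by lia.
  rewrite (fsum_ext (2 * L) (fun i => f (Z.of_nat (S i) - Z.of_nat (S L))%Z)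
             (fun i => f (Z.of_nat i - Z.of_nat L)%Z)).
  - ring.
  - intros i _. f_equal. lia.
Qed.

Lemma ssum_le (L : nat) (f g : Z -> R) :
  (forall i, (- Z.of_nat L <= i < Z.of_nat L)%Z -> f i <= g i) ->
  ssum L f <= ssum L g.
Proof.
  intros H. rewrite !ssum_fsum. apply fsum_le. intros i Hi. apply H. lia.
Qed.

Lemma ssum_ext (L : nat) (f g : Z -> R) :
  (forall i, (- Z.of_nat L <= i < Z.of_nat L)%Z -> f i = g i) ->
  ssum L f = ssum L g.
Proof.
  intros H; apply Rle_antisym; apply ssum_le; intros i Hi; rewrite (H i Hi); lra.
Qed.

Lemma ssum_plus (L : nat) (f g : Z -> R) :
  ssum L (fun i => f i + g i) = ssum L f + ssum L g.
Proof. rewrite !ssum_fsum. apply fsum_plus. Qed.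

Lemma ssum_scal (L : nat) (c : R) (f : Z -> R) :
  ssum L (fun i => c * f i) = c * ssum L f.
Proof. rewrite !ssum_fsum. apply (fsum_scal _ c). Qed.

Lemma ssum_const (L : nat) (c : R) : ssum L (fun _ => c) = 2 * INR L * c.
Proof. rewrite ssum_fsum, fsum_const, mult_INR. simpl. ring. Qed.

Lemma ssum_0 (L : nat) (f : Z -> R) :
  (forall i, (- Z.of_nat L <= i < Z.of_nat L)%Z -> f i = 0) -> ssum L f = 0.
Proof.
  intros H. rewrite (ssum_ext L f (fun _ => 0)) by exact H.
  rewrite ssum_const. ring.
Qed.

Lemma ssum_swap (L L' : nat) (f : Z -> Z -> R) :
  ssum L (fun i => ssum L' (fun j => f i j)) =
  ssum L' (fun j => ssum L (fun i => f i j)).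
Proof.
  induction L as [|L IH]; simpl ssum at 1.
  - symmetry. apply ssum_0. reflexivity.
  - rewrite IH, <- !ssum_plus. reflexivity.
Qed.

Lemma ssum_abs_le (L : nat) (f g : Z -> R) (e : R) :
  (forall i, (- Z.of_nat L <= i < Z.of_nat L)%Z -> Rabs (f i - g i) <= e) ->
  Rabs (ssum L f - ssum L g) <= 2 * INR L * e.
Proof.
  intros H. rewrite <- ssum_const.
  assert (H1 : ssum L f <= ssum L g + ssum L (fun _ => e)).
  { rewrite <- ssum_plus. apply ssum_le. intros i Hi.
    specialize (H i Hi). revert H. unfold Rabs. destruct Rcase_abs; lra. }
  assert (H2 : ssum L g <= ssum L f + ssum L (fun _ => e)).
  { rewrite <- ssum_plus. apply ssum_le. intros i Hi.
    specialize (H i Hi). revert H. unfold Rabs. destruct Rcase_abs; lra. }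
  apply Rabs_le. lra.
Qed.

Lemma ssum_extend (L L' : nat) (f : Z -> R) :
  (L <= L')%nat ->
  (forall i, ~ (- Z.of_nat L <= i < Z.of_nat L)%Z -> f i = 0) ->
  ssum L' f = ssum L f.
Proof.
  intros HL H. induction HL as [|L' HL IH]; [reflexivity|].
  simpl ssum at 1. rewrite IH, !H by lia. ring.
Qed.

(** Translating the window [[-L, L)] by one gains the term at [L] and loses the one at [-L]. This
    drives both the shift invariance and the telescoping of ramps. *)
Lemma ssum_succ (L : nat) (f : Z -> R) :
  ssum L (fun i => f (i + 1)%Z) = ssum L f + f (Z.of_nat L) - f (- Z.of_nat L)%Z.
Proof.
  induction L as [|L IH]; [simpl; ring|].
  change (ssum (S L) (fun i => f (i + 1)%Z))
    with (ssum L (fun i => f (i + 1)%Z) + f (Z.of_nat L + 1)%Z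
          + f (- Z.of_nat (S L) + 1)%Z).
  change (ssum (S L) f)
    with (ssum L f + f (Z.of_nat L) + f (- Z.of_nat (S L))%Z).
  rewrite IH.
  replace (Z.of_nat L + 1)%Z with (Z.of_nat (S L)) by lia.
  replace (- Z.of_nat (S L) + 1)%Z with (- Z.of_nat L)%Z by lia.
  ring.
Qed.

(** One unit shift at a time: the hypothesis kills the [k] terms entering on the right and the [k]
    terms leaving on the left. *)
Lemma ssum_shift_nat (L k : nat) (f : Z -> R) :
  (forall j, (0 <= j < Z.of_nat k)%Z ->
     f (Z.of_nat L + j)%Z = 0 /\ f (j - Z.of_nat L)%Z = 0) ->
  ssum L (fun i => f (i + Z.of_nat k)%Z) = ssum L f.
Proof.
  induction k as [|k IH]; intros H.
  - apply ssum_ext. intros i _. f_equal. lia.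
  - rewrite <- IH by (intros j Hj; apply H; lia).
    rewrite (ssum_ext L _ (fun i => (fun i => f (i + Z.of_nat k)%Z) (i + 1)%Z)).
    + rewrite (ssum_succ L (fun i => f (i + Z.of_nat k)%Z)).
      destruct (H (Z.of_nat k)) as [H1 H2]; [lia|].
      replace (- Z.of_nat L + Z.of_nat k)%Z with (Z.of_nat k - Z.of_nat L)%Z by lia.
      rewrite H1, H2. ring.
    + intros i _. cbv beta. f_equal. lia.
Qed.

(** A negative shift is undone by a positive one applied to the shifted function, so a hypothesis
    symmetric in the two ends serves both signs. *)
Lemma ssum_shift (L : nat) (k : Z) (f : Z -> R) :
  (forall i, (Z.of_nat L - Z.abs k <= Z.abs i)%Z -> f i = 0) ->
  ssum L (fun i => f (i + k)%Z) = ssum L f.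
Proof.
  intros H. destruct (Z_le_gt_dec 0 k) as [Hk|Hk].
  - rewrite <- (ssum_shift_nat L (Z.to_nat k) f).
    + apply ssum_ext. intros i _. f_equal. lia.
    + intros j Hj. split; apply H; lia.
  - rewrite <- (ssum_shift_nat L (Z.to_nat (- k)) (fun i => f (i + k)%Z)).
    + apply ssum_ext. intros i _. f_equal. lia.
    + intros j Hj. split; apply H; lia.
Qed.

(** Negation turns the asymmetric window [[-L, L)] into [(-L, L]], whence the two end terms. *)
Lemma ssum_opp (L : nat) (f : Z -> R) :
  ssum L (fun i => f (- i)%Z) = ssum L f + f (Z.of_nat L) - f (- Z.of_nat L)%Z.
Proof.
  induction L as [|L IH]; [simpl; ring|].
  change (ssum (S L) (fun i => f (- i)%Z))
    with (ssum L (fun i => f (- i)%Z) + f (- Z.of_nat L)%Z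
          + f (- - Z.of_nat (S L))%Z).
  change (ssum (S L) f)
    with (ssum L f + f (Z.of_nat L) + f (- Z.of_nat (S L))%Z).
  rewrite IH, Z.opp_involutive. ring.
Qed.

Lemma ssum_add (L B : nat) (f : Z -> R) :
  ssum (L + B) f =
  ssum L f + fsum B (fun r => f (Z.of_nat L + Z.of_nat r)%Z)
  + fsum B (fun r => f (- Z.of_nat L - Z.of_nat B + Z.of_nat r)%Z).
Proof.
  induction B as [|B IH].
  - rewrite Nat.add_0_r. unfold fsum; simpl; ring.
  - rewrite Nat.add_succ_r.
    change (ssum (S (L + B)) f)
      with (ssum (L + B) f + f (Z.of_nat (L + B)) + f (- Z.of_nat (S (L + B)))%Z).
    rewrite IH, fsum_S, fsum_Sl.
    rewrite (fsum_ext B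
      (fun i => f (- Z.of_nat L - Z.of_nat (S B) + Z.of_nat (S i))%Z)
      (fun r => f (- Z.of_nat L - Z.of_nat B + Z.of_nat r)%Z)).
    + replace (Z.of_nat (L + B)) with (Z.of_nat L + Z.of_nat B)%Z by lia.
      replace (- Z.of_nat (S (L + B)))%Z
        with (- Z.of_nat L - Z.of_nat (S B) + Z.of_nat 0)%Z by lia.
      ring.
    + intros i _. f_equal. lia.
Qed.

(** Division with remainder by [B]. It groups the points of a fine lattice by the cells of a coarser
    one. *)
Lemma ssum_block (A B : nat) (f : Z -> R) :
  ssum (A * B) f =
  ssum A (fun q => fsum B (fun r => f (q * Z.of_nat B + Z.of_nat r)%Z)).
Proof.
  induction A as [|A IH]; [reflexivity|].
  replace (S A * B)%nat with (A * B + B)%nat by lia.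
  rewrite ssum_add, IH.
  change (ssum (S A) (fun q => fsum B (fun r => f (q * Z.of_nat B + Z.of_nat r)%Z)))
    with (ssum A (fun q => fsum B (fun r => f (q * Z.of_nat B + Z.of_nat r)%Z))
          + fsum B (fun r => f (Z.of_nat A * Z.of_nat B + Z.of_nat r)%Z)
          + fsum B (fun r => f (- Z.of_nat (S A) * Z.of_nat B + Z.of_nat r)%Z)).
  f_equal; [f_equal|]; apply fsum_ext; intros r _; f_equal; lia.
Qed.

Lemma fsum_count_lt (K : nat) (t : R) : 0 <= t ->
  fsum K (fun r => if Rlt_dec (INR r) t then 1 else 0) <= t + 1.
Proof.
  intros Ht.
  (* The extra bound by [K] is what carries the induction while [K < t]. *)
  enough (H : fsum K (fun r => if Rlt_dec (INR r) t then 1 else 0) <= INR K /\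
              fsum K (fun r => if Rlt_dec (INR r) t then 1 else 0) <= t + 1)
    by apply H.
  induction K as [|K IH].
  - unfold fsum; simpl; lra.
  - rewrite fsum_S, S_INR. destruct Rlt_dec; lra.
Qed.

Lemma fsum_count_gt (K : nat) (t : R) : 0 <= t ->
  fsum K (fun r => if Rlt_dec (INR K - t) (INR r) then 1 else 0) <= t.
Proof.
  intros Ht.
  (* [K] is both the length and part of the threshold; the induction on the length needs a threshold
     [c] that stays fixed. *)
  enough (H : forall c n,
    fsum n (fun r => if Rlt_dec c (INR r) then 1 else 0) <= Rmax 0 (INR n - c)).
  { eapply Rle_trans; [apply H|]. apply Rmax_lub; lra. }
  intros c n. induction n as [|n IH].
  - unfold fsum; simpl. apply Rmax_l.
  - rewrite fsum_S, S_INR. revert IH. unfold Rmax.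
    repeat destruct Rle_dec; destruct Rlt_dec; lra.
Qed.

(** * Lattice sums and reflections *)

Definition mesh (n : nat) : R := / 2 ^ n.

Lemma mesh_pos (n : nat) : 0 < mesh n.
Proof. apply Rinv_0_lt_compat, pow_lt; lra. Qed.

Lemma mesh_le (n m : nat) : (n <= m)%nat -> mesh m <= mesh n.
Proof.
  intros H. apply Rinv_le_contravar; [apply pow_lt; lra|].
  apply Rle_pow; [lra|exact H].
Qed.

Lemma mesh_le1 (n : nat) : mesh n <= 1.
Proof. replace 1 with (mesh 0) by (unfold mesh; simpl; field). apply mesh_le; lia. Qed.

Lemma mesh_small (e : R) : 0 < e -> exists n0, forall n, (n0 <= n)%nat -> mesh n <= e.
Proof.
  intros He.
  destruct (pow_lt_1_zero (/ 2)) with (y := e) as [n0 H0]; [|exact He|].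
  { rewrite Rabs_right; lra. }
  exists n0. intros n Hn. specialize (H0 n Hn).
  rewrite pow_inv in H0. fold (mesh n) in H0.
  rewrite Rabs_right in H0; [lra|]. pose proof (mesh_pos n); lra.
Qed.

Lemma INR_pow2 (n : nat) : INR (2 ^ n) = 2 ^ n.
Proof. rewrite pow_INR. reflexivity. Qed.

Lemma mesh_box (W n : nat) : INR (W * 2 ^ n) * mesh n = INR W.
Proof.
  rewrite mult_INR, INR_pow2. unfold mesh. field.
  apply pow_nonzero; lra.
Qed.

Lemma mesh_box_Z (W n : nat) : IZR (Z.of_nat (W * 2 ^ n)) * mesh n = INR W.
Proof. rewrite <- INR_IZR_INZ. apply mesh_box. Qed.

Lemma mesh_add (k p : nat) : INR (2 ^ p) * mesh (k + p) = mesh k.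
Proof.
  rewrite INR_pow2. unfold mesh. rewrite pow_add. field.
  split; apply pow_nonzero; lra.
Qed.

(** The Riemann sum over [[-W, W)^2], sampled at the lower left corners of the cells. Unlike the
    upper integral, it is additive in [f] by construction. *)
Definition gridsum (n W : nat) (f : pt -> R) : R :=
  ssum (W * 2 ^ n) (fun i => ssum (W * 2 ^ n) (fun j =>
    mesh n * mesh n * f (IZR i * mesh n, IZR j * mesh n))).

Lemma gridsum_le (n W : nat) (f g : pt -> R) :
  (forall z, f z <= g z) -> gridsum n W f <= gridsum n W g.
Proof.
  intros H. pose proof (mesh_pos n). apply ssum_le; intros i _.
  apply ssum_le; intros j _. apply Rmult_le_compat_l; [nra|apply H].
Qed.

Lemma gridsum_ext (n W : nat) (f g : pt -> R) :
  (forall z, f z = g z) -> gridsum n W f = gridsum n W g.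
Proof.
  intros H; apply Rle_antisym; apply gridsum_le; intros z; rewrite (H z); lra.
Qed.

Lemma gridsum_plus (n W : nat) (f g : pt -> R) :
  gridsum n W (fun z => f z + g z) = gridsum n W f + gridsum n W g.
Proof.
  unfold gridsum. rewrite <- ssum_plus. apply ssum_ext; intros i _.
  rewrite <- ssum_plus. apply ssum_ext; intros j _. ring.
Qed.

Lemma gridsum_swap (n W : nat) (f : pt -> R) :
  gridsum n W (fun z => f (snd z, fst z)) = gridsum n W f.
Proof. unfold gridsum. rewrite ssum_swap. reflexivity. Qed.

(** * Lattice sums of Lipschitz functions of bounded support under shears and reflections *)

Definition vanish (a : R) (f : pt -> R) : Prop :=
  forall z, a <= Rabs (fst z) \/ a <= Rabs (snd z) -> f z = 0.

Definition lip (f : pt -> R) : Prop :=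
  exists C, 0 <= C /\ forall z w,
    Rabs (f z - f w) <= C * (Rabs (fst z - fst w) + Rabs (snd z - snd w)).

Definition lipc (f : pt -> R) : Prop := lip f /\ exists a, vanish a f.

(** Equality of the integrals of [f] and [g] over the plane, stated without limits: on every large
    enough box the lattice sums differ by a quantity tending to [0]. *)
Definition approx (f g : pt -> R) : Prop :=
  exists W0, forall W, (W0 <= W)%nat -> forall e, 0 < e ->
  exists n0, forall n, (n0 <= n)%nat -> Rabs (gridsum n W f - gridsum n W g) <= e.

Lemma approx_trans (f g k : pt -> R) : approx f g -> approx g k -> approx f k.
Proof.
  intros [W1 H1] [W2 H2]. exists (max W1 W2). intros W HW e He.
  destruct (H1 W ltac:(lia) (e / 2) ltac:(lra)) as [n1 K1].
  destruct (H2 W ltac:(lia) (e / 2) ltac:(lra)) as [n2 K2].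
  exists (max n1 n2). intros n Hn.
  specialize (K1 n ltac:(lia)). specialize (K2 n ltac:(lia)).
  replace (gridsum n W f - gridsum n W k)
    with ((gridsum n W f - gridsum n W g) + (gridsum n W g - gridsum n W k)) by ring.
  eapply Rle_trans; [apply Rabs_triang|]. lra.
Qed.

Lemma approx_ext (f g f' : pt -> R) :
  (forall z, f z = f' z) -> approx f g -> approx f' g.
Proof.
  intros E [W0 H]. exists W0. intros W HW e He.
  destruct (H W HW e He) as [n0 K]. exists n0. intros n Hn.
  rewrite <- (gridsum_ext n W f f' E). apply K, Hn.
Qed.

Definition swap (z : pt) : pt := (snd z, fst z).

Lemma approx_swap (f g : pt -> R) :
  approx f g -> approx (fun z => f (swap z)) (fun z => g (swap z)).
Proof.
  intros [W0 H]. exists W0. intros W HW e He.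
  destruct (H W HW e He) as [n0 K]. exists n0. intros n Hn.
  unfold swap. rewrite !gridsum_swap. apply K, Hn.
Qed.

(* The translation by [s] is rounded to a multiple of the mesh, and
   the rounded translation only permutes the terms of the sum. *)
Lemma row_shift (n W : nat) (f : R -> R) (C a B s sg : R) :
  0 <= C -> (forall x x', Rabs (f x - f x') <= C * Rabs (x - x')) ->
  (forall x, a <= Rabs x -> f x = 0) ->
  Rabs s <= B -> a + B + 1 <= INR W -> sg = 1 \/ sg = -1 ->
  Rabs (ssum (W * 2 ^ n) (fun i => f (sg * (IZR i * mesh n) + s)) -
        ssum (W * 2 ^ n) (fun i => f (IZR i * mesh n)))
  <= 2 * INR (W * 2 ^ n) * (C * mesh n).
Proof.
  intros HC Hlip Hvan Hs HW Hsg.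
  pose proof (mesh_pos n) as Hd. pose proof (mesh_le1 n) as Hd1.
  set (d := mesh n) in *.
  set (k := Int_part (s / d)).
  destruct (base_Int_part (s / d)) as [Hk1 Hk2]. fold k in Hk1, Hk2.
  assert (Hk1' : IZR k * d <= s).
  { apply (Rmult_le_compat_r d) in Hk1; [|lra].
    replace (s / d * d) with s in Hk1 by (field; lra). exact Hk1. }
  assert (Hk2' : s - d <= IZR k * d).
  { assert (Hk3 : s / d - 1 <= IZR k) by lra.
    apply (Rmult_le_compat_r d) in Hk3; [|lra].
    replace ((s / d - 1) * d) with (s - d) in Hk3 by (field; lra). exact Hk3. }
  pose proof (mesh_box_Z W n) as HL. fold d in HL.
  set (L := (W * 2 ^ n)%nat) in *.
  assert (Hk : Rabs (IZR k) * d <= B + 1).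
  { rewrite <- (Rabs_right d) by lra. rewrite <- Rabs_mult.
    revert Hs. unfold Rabs. repeat destruct Rcase_abs; lra. }
  assert (Hzero : forall i, (Z.of_nat L - Z.abs k <= Z.abs i)%Z -> f (IZR i * d) = 0).
  { intros i Hi. apply Hvan. apply IZR_le in Hi.
    rewrite minus_IZR, !abs_IZR in Hi.
    rewrite Rabs_mult, (Rabs_right d) by lra. nra. }
  assert (E : ssum L (fun i => f (IZR i * d)) =
    ssum L (fun i => f ((sg * IZR i + IZR k) * d))).
  { rewrite <- (ssum_shift L k (fun i => f (IZR i * d))) by exact Hzero.
    destruct Hsg as [-> | ->].
    - apply ssum_ext. intros i _. rewrite plus_IZR. f_equal. ring.
    (* For a flip, the two end terms left over by [ssum_opp] vanish because they lie outside the
       support. *)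
    - pose proof (ssum_opp L (fun i => f (IZR (i + k) * d))) as Ho. cbv beta in Ho.
      rewrite (Hzero (Z.of_nat L + k)%Z), (Hzero (- Z.of_nat L + k)%Z) in Ho by lia.
      rewrite Rminus_0_r, Rplus_0_r in Ho. rewrite <- Ho.
      apply ssum_ext. intros i _. rewrite plus_IZR, opp_IZR. f_equal. ring. }
  rewrite E. apply ssum_abs_le. intros i _.
  eapply Rle_trans; [apply Hlip|]. apply Rmult_le_compat_l; [exact HC|].
  apply Rabs_le. nra.
Qed.

Definition xshear (sg t u : R) (z : pt) : pt := (sg * fst z + t * snd z + u, snd z).

(** The map sends each horizontal line to itself, acting there as a translation, preceded by a flip
    if [sg = -1]; so [row_shift] applies row by row. *)
Lemma approx_xshear (sg t u : R) (f : pt -> R) :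
  sg = 1 \/ sg = -1 -> lipc f -> approx (fun z => f (xshear sg t u z)) f.
Proof.
  intros Hsg [[C [HC Hlip]] [a Hvan]].
  (* A row with [a <= Rabs y] contributes nothing; on the others the translation [t * y + u] is at
     most [B] in absolute value. *)
  set (B := Rabs t * Rabs a + Rabs u).
  assert (HB : 0 <= B).
  { unfold B. pose proof (Rabs_pos t); pose proof (Rabs_pos a);
    pose proof (Rabs_pos u); nra. }
  destruct (INR_unbounded (Rabs a + B + 1)) as [W0 HW0].
  exists W0. intros W HW e He. apply le_INR in HW.
  pose proof (Rle_abs a) as Ha.
  assert (HW2 : 0 <= INR W) by apply pos_INR.
  (* The row errors add up to [4 * W^2 * C * mesh n]; the [+ 1] keeps the denominator positive. *)
  destruct (mesh_small (e / (4 * INR W * INR W * C + 1))) as [n0 Hn0].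
  { apply Rdiv_lt_0_compat; nra. }
  exists n0. intros n Hn. specialize (Hn0 n Hn). clear Hn.
  pose proof (mesh_pos n) as Hd. pose proof (mesh_box W n) as HL.
  unfold gridsum. rewrite ssum_swap.
  rewrite (ssum_swap _ _ (fun i j => mesh n * mesh n * f (IZR i * mesh n, IZR j * mesh n))).
  assert (Hmain : Rabs
    (ssum (W * 2 ^ n) (fun j => ssum (W * 2 ^ n) (fun i =>
       mesh n * mesh n * f (xshear sg t u (IZR i * mesh n, IZR j * mesh n)))) -
     ssum (W * 2 ^ n) (fun j => ssum (W * 2 ^ n) (fun i =>
       mesh n * mesh n * f (IZR i * mesh n, IZR j * mesh n))))
    <= 2 * INR (W * 2 ^ n) * (mesh n * mesh n * (2 * INR (W * 2 ^ n) * (C * mesh n)))).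
  { apply ssum_abs_le. intros j _. rewrite !ssum_scal.
    rewrite <- Rmult_minus_distr_l, Rabs_mult.
    rewrite (Rabs_right (mesh n * mesh n)) by nra.
    apply Rmult_le_compat_l; [nra|].
    unfold xshear; simpl fst; simpl snd.
    destruct (Rle_lt_dec a (Rabs (IZR j * mesh n))) as [Hj|Hj].
    - rewrite !ssum_0; try (intros i _; apply Hvan; right; exact Hj).
      rewrite Rminus_0_r, Rabs_R0.
      pose proof (pos_INR (W * 2 ^ n)).
      apply Rmult_le_pos; [lra|]. apply Rmult_le_pos; lra.
    - rewrite (ssum_ext _
        (fun i => f (sg * (IZR i * mesh n) + t * (IZR j * mesh n) + u, IZR j * mesh n))
        (fun i => (fun x => f (x, IZR j * mesh n))
                    (sg * (IZR i * mesh n) + (t * (IZR j * mesh n) + u))))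
        by (intros i _; rewrite Rplus_assoc; reflexivity).
      apply (row_shift n W (fun x => f (x, IZR j * mesh n)) C a B); try assumption.
      + intros x x'. eapply Rle_trans; [apply Hlip|]. simpl.
        rewrite Rminus_diag, Rabs_R0. lra.
      + intros x Hx. apply Hvan. left. exact Hx.
      + unfold B. eapply Rle_trans; [apply Rabs_triang|].
        apply Rplus_le_compat_r. rewrite Rabs_mult.
        apply Rmult_le_compat_l; [apply Rabs_pos|]. lra.
      + lra. }
  eapply Rle_trans; [exact Hmain|].
  replace (2 * INR (W * 2 ^ n) * (mesh n * mesh n * (2 * INR (W * 2 ^ n) * (C * mesh n))))
    with (4 * (INR (W * 2 ^ n) * mesh n) * (INR (W * 2 ^ n) * mesh n) * C * mesh n) by ring.
  rewrite HL.
  apply (Rmult_le_compat_r (4 * INR W * INR W * C + 1)) in Hn0; [|nra].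
  replace (e / (4 * INR W * INR W * C + 1) * (4 * INR W * INR W * C + 1))
    with e in Hn0 by (field; nra).
  nra.
Qed.

Lemma lipc_xshear (sg t u : R) (f : pt -> R) :
  sg = 1 \/ sg = -1 -> lipc f -> lipc (fun z => f (xshear sg t u z)).
Proof.
  intros Hsg [[C [HC Hlip]] [a Hvan]]. split.
  - exists (C * (1 + Rabs t)). pose proof (Rabs_pos t) as Ht.
    split; [nra|]. intros z w. eapply Rle_trans; [apply Hlip|].
    unfold xshear; simpl.
    replace (sg * fst z + t * snd z + u - (sg * fst w + t * snd w + u))
      with (sg * (fst z - fst w) + t * (snd z - snd w)) by ring.
    assert (H : Rabs (sg * (fst z - fst w) + t * (snd z - snd w)) <=
            Rabs (fst z - fst w) + Rabs t * Rabs (snd z - snd w)).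
    { eapply Rle_trans; [apply Rabs_triang|]. rewrite !Rabs_mult.
      replace (Rabs sg) with 1; [lra|].
      destruct Hsg as [-> | ->]; unfold Rabs; destruct Rcase_abs; lra. }
    rewrite Rmult_assoc. apply Rmult_le_compat_l; [exact HC|].
    pose proof (Rabs_pos (fst z - fst w)). pose proof (Rabs_pos (snd z - snd w)).
    nra.
  (* Where [Rabs y < a], the shear changes the absolute value of the first coordinate by at most
     [Rabs t * Rabs a + Rabs u]. *)
  - exists (Rabs a + Rabs t * Rabs a + Rabs u). intros z Hz. apply Hvan.
    unfold xshear; simpl.
    pose proof (Rabs_pos t). pose proof (Rabs_pos a). pose proof (Rabs_pos u).
    pose proof (Rle_abs a).
    destruct (Rle_lt_dec a (Rabs (snd z))) as [H3|H3]; [right; exact H3|].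
    left. destruct Hz as [Hz|Hz]; [|nra].
    assert (H4 : Rabs (t * snd z) <= Rabs t * Rabs a).
    { rewrite Rabs_mult. apply Rmult_le_compat_l; lra. }
    set (b := t * snd z) in *. set (D := Rabs t * Rabs a) in *. clearbody b D.
    destruct Hsg as [-> | ->]; revert Hz H4; unfold Rabs;
      repeat destruct Rcase_abs; lra.
Qed.

Lemma lipc_swap (f : pt -> R) : lipc f -> lipc (fun z => f (swap z)).
Proof.
  intros [[C [HC Hlip]] [a Hvan]]. split.
  - exists C. split; [exact HC|]. intros z w.
    eapply Rle_trans; [apply Hlip|]. unfold swap; simpl. lra.
  - exists a. intros z Hz. apply Hvan. unfold swap; simpl. tauto.
Qed.

Definition yshear (sg t u : R) (z : pt) : pt := (fst z, sg * snd z + t * fst z + u).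

Lemma swapK (z : pt) : swap (swap z) = z.
Proof. destruct z; reflexivity. Qed.

(** A y-shear is an x-shear conjugated by the exchange of coordinates. *)
Lemma lipc_yshear (sg t u : R) (f : pt -> R) :
  sg = 1 \/ sg = -1 -> lipc f -> lipc (fun z => f (yshear sg t u z)).
Proof.
  intros Hsg Hf.
  apply (lipc_swap (fun z => f (swap (xshear sg t u z)))).
  apply (lipc_xshear sg t u (fun z => f (swap z)) Hsg).
  apply lipc_swap, Hf.
Qed.

Lemma approx_yshear (sg t u : R) (f : pt -> R) :
  sg = 1 \/ sg = -1 -> lipc f -> approx (fun z => f (yshear sg t u z)) f.
Proof.
  intros Hsg Hf.
  pose proof (approx_swap _ _
    (approx_xshear sg t u (fun z => f (swap z)) Hsg (lipc_swap f Hf))) as [W0 H].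
  exists W0. intros W HW e He. destruct (H W HW e He) as [n0 K].
  exists n0. intros n Hn. specialize (K n Hn). cbv beta in K.
  rewrite (gridsum_ext n W (fun z => f (swap (swap z))) f) in K
    by (intros z; rewrite swapK; reflexivity).
  exact K.
Qed.

(* When [snd v <> 0], the x-shear taking [v] to the vertical axis conjugates
   the reflection to a vertical flip along an oblique mirror. *)
Lemma approx_refl (v : pt) (c : R) (f : pt -> R) :
  unit_vec v -> lipc f -> approx (fun z => f (refl v c z)) f.
Proof.
  destruct v as [p q]. unfold unit_vec; simpl fst; simpl snd. intros Hv Hf.
  destruct (Req_dec q 0) as [Hq|Hq].
  (* Here [p] is [1] or [-1], and the reflection is the horizontal flip [x] to [- x + 2 * c * p]. *)
  - subst q. apply (approx_ext (fun z => f (xshear (-1) 0 (2 * c * p) z))).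
    + intros [x y]. unfold xshear, refl, dot; simpl. f_equal.
      f_equal; [|ring].
      replace (x - 2 * (x * p + y * 0 - c) * p)
        with (x - 2 * x * (p * p) + 2 * c * p) by ring.
      replace (p * p) with 1 by nra. ring.
    + apply approx_xshear; [right; reflexivity|exact Hf].
  - set (f1 := fun z => f (xshear 1 (p / q) 0 z)).
    assert (Hf1 : lipc f1) by (apply lipc_xshear; [left; reflexivity|exact Hf]).
    (* In the sheared coordinates the mirror is [y = q * c - q * p * x], because [p^2 + q^2 = 1];
       the flip sends [y] to twice this value minus [y]. *)
    set (f2 := fun z => f1 (yshear (-1) (- 2 * q * p) (2 * q * c) z)).
    assert (Hf2 : lipc f2) by (apply lipc_yshear; [right; reflexivity|exact Hf1]).
    apply (approx_ext (fun z => f2 (xshear 1 (- p / q) 0 z))).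
    + intros [x y]. unfold f2, f1, xshear, yshear, refl, dot; simpl. f_equal.
      assert (Hq2 : q * q = 1 - p * p) by nra.
      f_equal.
      * apply (Rmult_eq_reg_l q); [|exact Hq]. field_simplify; [|exact Hq..].
        replace (q ^ 2) with (1 - p * p) by (simpl; lra).
        replace (q ^ 3) with (q * (1 - p * p)) by (rewrite <- Hq2; ring). ring.
      * field_simplify; [|exact Hq..].
        replace (q ^ 2) with (1 - p * p) by (simpl; lra). ring.
    + apply (approx_trans _ f2); [apply approx_xshear; [left; reflexivity|exact Hf2]|].
      apply (approx_trans _ f1); [apply approx_yshear; [right; reflexivity|exact Hf1]|].
      apply approx_xshear; [left; reflexivity|exact Hf].
Qed.

(** * The Darboux integral and cutoffs *)

Lemma Rsup_ub (E : R -> Prop) (x : R) : bound E -> E x -> x <= Rsup E.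
Proof.
  intros Hb Hx. unfold Rsup. destruct excluded_middle_informative as [H|H].
  - apply (proj2_sig (completeness E (proj1 H) (proj2 H))), Hx.
  - exfalso; apply H; split; [exact Hb|exists x; exact Hx].
Qed.

(** The condition [0 <= b] covers the default value of [Rsup]; for a non-empty set the default
    cannot occur, as [Rsup_le_nonempty] exploits. *)
Lemma Rsup_le (E : R -> Prop) (b : R) :
  0 <= b -> (forall x, E x -> x <= b) -> Rsup E <= b.
Proof.
  intros H0 Hb. unfold Rsup. destruct excluded_middle_informative as [H|H].
  - apply (proj2_sig (completeness E (proj1 H) (proj2 H))). exact Hb.
  - exact H0.
Qed.

Lemma Rsup_le_nonempty (E : R -> Prop) (b : R) :
  (exists x, E x) -> (forall x, E x -> x <= b) -> Rsup E <= b.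
Proof.
  intros He Hb. unfold Rsup. destruct excluded_middle_informative as [H|H].
  - apply (proj2_sig (completeness E (proj1 H) (proj2 H))). exact Hb.
  - exfalso; apply H; split; [exists b; exact Hb|exact He].
Qed.

Lemma Rsup_ge0 (E : R -> Prop) : (forall x, E x -> 0 <= x) -> 0 <= Rsup E.
Proof.
  intros H0. unfold Rsup. destruct excluded_middle_informative as [H|H]; [|lra].
  assert (Hx : exists x, E x) by apply H. destruct Hx as [x Hx].
  apply (Rle_trans _ x); [apply H0, Hx|].
  apply (proj2_sig (completeness E (proj1 H) (proj2 H))), Hx.
Qed.

Lemma Rinf_lb (E : R -> Prop) (x : R) :
  (forall y, E y -> 0 <= y) -> E x -> Rinf E <= x.
Proof.
  intros H0 Hx. unfold Rinf. apply Ropp_le_cancel. rewrite Ropp_involutive.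
  apply Rsup_ub.
  - exists 0. intros y Hy. apply H0 in Hy. lra.
  - rewrite Ropp_involutive. exact Hx.
Qed.

Lemma Rinf_ge (E : R -> Prop) (b : R) :
  (exists x, E x) -> (forall x, E x -> b <= x) -> b <= Rinf E.
Proof.
  intros [x Hx] Hb. unfold Rinf. apply Ropp_le_cancel. rewrite Ropp_involutive.
  apply Rsup_le_nonempty.
  - exists (- x). rewrite Ropp_involutive. exact Hx.
  - intros y Hy. apply Hb in Hy. lra.
Qed.

Lemma Rinf_approx (E : R -> Prop) (e : R) :
  (exists x, E x) -> 0 < e -> exists x, E x /\ x <= Rinf E + e.
Proof.
  intros HE He. apply NNPP. intros H.
  enough (H1 : Rinf E + e <= Rinf E) by lra.
  apply Rinf_ge; [exact HE|]. intros x Hx. apply Rnot_lt_le. intros Hlt.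
  apply H. exists x. split; [exact Hx|lra].
Qed.

(** * Euclidean distance and Lipschitz functions *)

Definition edist (z w : pt) : R := sqrt (dist2 z w).

Lemma dist2_ge0 (z w : pt) : 0 <= dist2 z w.
Proof. apply Rplus_le_le_0_compat; apply pow2_ge_0. Qed.

Lemma edist_ge0 (z w : pt) : 0 <= edist z w.
Proof. apply sqrt_pos. Qed.

Lemma edist_sq (z w : pt) : edist z w * edist z w = dist2 z w.
Proof. apply sqrt_sqrt, dist2_ge0. Qed.

Lemma edist_dist_euc (z w : pt) :
  edist z w = dist_euc (fst z) (snd z) (fst w) (snd w).
Proof. unfold edist, dist_euc, dist2, Rsqr. f_equal. ring. Qed.

Lemma edist_sym (z w : pt) : edist z w = edist w z.
Proof. unfold edist, dist2. f_equal. ring. Qed.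

Lemma edist_triangle (z w y : pt) : edist z y <= edist z w + edist w y.
Proof. rewrite !edist_dist_euc. apply triangle. Qed.

Lemma edist_refl0 (z : pt) : edist z z = 0.
Proof.
  unfold edist, dist2. rewrite !Rminus_diag, pow_ne_zero, Rplus_0_r by discriminate.
  apply sqrt_0.
Qed.

Lemma edist_lt (z w : pt) (r : R) : 0 < r -> edist z w < r <-> dist2 z w < r ^ 2.
Proof.
  intros Hr. rewrite <- edist_sq. pose proof (edist_ge0 z w). split; nra.
Qed.

Lemma edist_le_of_dist2 (z w z' w' : pt) :
  dist2 z w <= dist2 z' w' -> edist z w <= edist z' w'.
Proof. apply sqrt_le_1_alt. Qed.

Lemma edist_fst (z w : pt) : Rabs (fst z - fst w) <= edist z w.
Proof.
  pose proof (edist_ge0 z w). pose proof (edist_sq z w) as H1.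
  unfold dist2 in H1. pose proof (pow2_ge_0 (fst z - fst w)).
  pose proof (pow2_ge_0 (snd z - snd w)). apply Rabs_le. split; nra.
Qed.

Lemma edist_snd (z w : pt) : Rabs (snd z - snd w) <= edist z w.
Proof.
  pose proof (edist_ge0 z w). pose proof (edist_sq z w) as H1.
  unfold dist2 in H1. pose proof (pow2_ge_0 (fst z - fst w)).
  pose proof (pow2_ge_0 (snd z - snd w)). apply Rabs_le. split; nra.
Qed.

Lemma edist_le_l1 (z w : pt) :
  edist z w <= Rabs (fst z - fst w) + Rabs (snd z - snd w).
Proof.
  pose proof (Rabs_pos (fst z - fst w)) as H1.
  pose proof (Rabs_pos (snd z - snd w)) as H2.
  pose proof (edist_ge0 z w). pose proof (edist_sq z w) as H3.
  unfold dist2 in H3. rewrite <- (pow2_abs (fst z - fst w)) in H3.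
  rewrite <- (pow2_abs (snd z - snd w)) in H3. nra.
Qed.

(** While [lip] uses the sum distance, suited to lattice rows and shears, this form uses the
    Euclidean distance, which reflections preserve, and keeps the constant explicit. *)
Definition elip (C : R) (f : pt -> R) : Prop :=
  0 <= C /\ forall z w, Rabs (f z - f w) <= C * edist z w.

Lemma elip_of_le (C : R) (f : pt -> R) :
  0 <= C -> (forall z w, f z <= f w + C * edist z w) -> elip C f.
Proof.
  intros HC H. split; [exact HC|]. intros z w.
  pose proof (H z w). pose proof (H w z) as H2. rewrite edist_sym in H2.
  apply Rabs_le. lra.
Qed.

Lemma elip_le (C : R) (f : pt -> R) (z w : pt) :
  elip C f -> f z <= f w + C * edist z w.
Proof.
  intros [_ H]. specialize (H z w). revert H. unfold Rabs.
  destruct Rcase_abs; lra.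
Qed.

Lemma elip_lip (C : R) (f : pt -> R) : elip C f -> lip f.
Proof.
  intros [HC H]. exists C. split; [exact HC|]. intros z w.
  eapply Rle_trans; [apply H|]. apply Rmult_le_compat_l; [exact HC|].
  apply edist_le_l1.
Qed.

Lemma elip_mult (C1 C2 M : R) (f g : pt -> R) :
  elip C1 f -> elip C2 g -> (forall z, 0 <= f z <= 1) -> (forall z, 0 <= g z <= M) ->
  elip (C1 * M + C2) (fun z => f z * g z).
Proof.
  intros [HC1 H1] [HC2 H2] Hf Hg.
  assert (HM : 0 <= M) by (destruct (Hg (0, 0)); lra).
  split; [nra|]. intros z w. specialize (H1 z w). specialize (H2 z w).
  replace (f z * g z - f w * g w)
    with ((f z - f w) * g z + f w * (g z - g w)) by ring.
  eapply Rle_trans; [apply Rabs_triang|]. rewrite !Rabs_mult.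
  rewrite (Rabs_right (g z)), (Rabs_right (f w)) by (apply Rle_ge; apply Hg || apply Hf).
  specialize (Hf w). specialize (Hg z).
  pose proof (Rabs_pos (f z - f w)). pose proof (Rabs_pos (g z - g w)). nra.
Qed.

(** * Lipschitz cutoffs of a set *)

(** For non-empty [Om] this is [max 0 (1 - m dist (z, Om))], written as a supremum over points of
    [Om] so that the distance to a set need not be defined. For empty [Om] the default makes it
    [0]. *)
Definition cutoff (Om : pt -> Prop) (m : R) (z : pt) : R :=
  Rsup (fun s => exists y, Om y /\ s = Rmax 0 (1 - m * edist z y)).

Lemma cutoff_bound (Om : pt -> Prop) (m : R) (z : pt) : 0 < m ->
  bound (fun s => exists y, Om y /\ s = Rmax 0 (1 - m * edist z y)).
Proof.
  intros Hm. exists 1. intros s [y [_ ->]]. pose proof (edist_ge0 z y).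
  apply Rmax_lub; nra.
Qed.

Lemma cutoff_ge (Om : pt -> Prop) (m : R) (z y : pt) :
  0 < m -> Om y -> 1 - m * edist z y <= cutoff Om m z.
Proof.
  intros Hm Hy. apply (Rle_trans _ (Rmax 0 (1 - m * edist z y))); [apply Rmax_r|].
  apply Rsup_ub; [apply cutoff_bound, Hm|]. exists y. tauto.
Qed.

Lemma cutoff_01 (Om : pt -> Prop) (m : R) (z : pt) :
  0 < m -> 0 <= cutoff Om m z <= 1.
Proof.
  intros Hm. split.
  - apply Rsup_ge0. intros s [y [_ ->]]. apply Rmax_l.
  - apply Rsup_le; [lra|]. intros s [y [_ ->]]. pose proof (edist_ge0 z y).
    apply Rmax_lub; nra.
Qed.

Lemma cutoff_in (Om : pt -> Prop) (m : R) (z : pt) :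
  0 < m -> Om z -> cutoff Om m z = 1.
Proof.
  intros Hm Hz. apply Rle_antisym; [apply cutoff_01, Hm|].
  pose proof (cutoff_ge Om m z z Hm Hz) as H. rewrite edist_refl0 in H. lra.
Qed.

Lemma cutoff_far (Om : pt -> Prop) (m : R) (z : pt) : 0 < m ->
  (forall y, Om y -> 1 <= m * edist z y) -> cutoff Om m z = 0.
Proof.
  intros Hm H. apply Rle_antisym; [|apply cutoff_01, Hm].
  apply Rsup_le; [lra|]. intros s [y [Hy ->]]. apply H in Hy.
  apply Rmax_lub; lra.
Qed.

Lemma cutoff_elip (Om : pt -> Prop) (m : R) : 0 < m -> elip m (cutoff Om m).
Proof.
  intros Hm. apply elip_of_le; [lra|]. intros z w. apply Rsup_le.
  - pose proof (cutoff_01 Om m w Hm). pose proof (edist_ge0 z w). nra.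
  - intros s [y [Hy ->]]. pose proof (cutoff_01 Om m w Hm).
    pose proof (edist_ge0 z w). apply Rmax_lub; [nra|].
    pose proof (cutoff_ge Om m w y Hm Hy). pose proof (edist_triangle w z y) as H2.
    rewrite (edist_sym w z) in H2. nra.
Qed.

(** Comparison by competitors: each point of [Om] seen from [z] is matched by one at least as near
    to [z']. The folding hypothesis will supply the match. *)
Lemma cutoff_le (Om : pt -> Prop) (m : R) (z z' : pt) : 0 < m ->
  (forall y, Om y -> exists y', Om y' /\ edist z' y' <= edist z y) ->
  cutoff Om m z <= cutoff Om m z'.
Proof.
  intros Hm H. apply Rsup_le; [apply cutoff_01, Hm|].
  intros s [y [Hy ->]]. destruct (H y Hy) as [y' [Hy' Hle]].
  apply Rmax_lub; [apply cutoff_01, Hm|].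
  pose proof (cutoff_ge Om m z' y' Hm Hy'). nra.
Qed.

Definition in_box (N : nat) (Om : pt -> Prop) : Prop :=
  forall z, Om z -> - INR N <= fst z <= INR N /\ - INR N <= snd z <= INR N.

Lemma cutoff_vanish (Om : pt -> Prop) (N : nat) (m : R) :
  in_box N Om -> 1 <= m -> vanish (INR N + 1) (cutoff Om m).
Proof.
  intros HN Hm z Hz. apply cutoff_far; [lra|]. intros y Hy.
  destruct (HN y Hy) as [H1 H2].
  pose proof (edist_fst z y) as Hf. pose proof (edist_snd z y) as Hs.
  assert (1 <= edist z y); [|nra].
  destruct Hz as [Hz|Hz].
  - revert Hz Hf. unfold Rabs. repeat destruct Rcase_abs; lra.
  - revert Hz Hs. unfold Rabs. repeat destruct Rcase_abs; lra.
Qed.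

(** * Upper sums over dyadic cells compared with lattice sums *)

Definition cell (n : nat) (i j : Z) (y : pt) : Prop :=
  IZR i * mesh n <= fst y < (IZR i + 1) * mesh n /\
  IZR j * mesh n <= snd y < (IZR j + 1) * mesh n.

(** An open cell that meets [[-N, N]^2] lies inside it, whereas the half-open cell starting at [N]
    contains points of the right or upper edge. This lets the box be enlarged without new
    contributions. *)
Definition open_cell (n : nat) (i j : Z) (y : pt) : Prop :=
  IZR i * mesh n < fst y < (IZR i + 1) * mesh n /\
  IZR j * mesh n < snd y < (IZR j + 1) * mesh n.

Definition sup_over (A : pt -> Prop) (F : pt -> R) : R :=
  Rsup (fun s => exists y, A y /\ s = F y).

Lemma Rsup_ext (E E' : R -> Prop) : (forall s, E s <-> E' s) -> Rsup E = Rsup E'.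
Proof.
  intros H. unfold Rsup.
  assert (K : (bound E /\ exists x, E x) <-> (bound E' /\ exists x, E' x)).
  { unfold bound, is_upper_bound. split; intros [[b Hb] [x Hx]]; split;
      (exists b; intros y Hy; apply Hb, H, Hy) || (exists x; apply H, Hx). }
  destruct (excluded_middle_informative (bound E /\ _)) as [H1|H1];
  destruct (excluded_middle_informative (bound E' /\ _)) as [H2|H2]; try tauto.
  destruct completeness as [s [Hs1 Hs2]]; destruct completeness as [s' [Hs1' Hs2']].
  simpl. apply Rle_antisym.
  - apply Hs2. intros y Hy. apply Hs1', H, Hy.
  - apply Hs2'. intros y Hy. apply Hs1, H, Hy.
Qed.

Lemma upper_sum_ssum (Om : pt -> Prop) (F : pt -> R) (n N : nat) :
  upper_sum Om F n N =
  ssum (N * 2 ^ n) (fun i => ssum (N * 2 ^ n) (fun j =>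
    mesh n * mesh n * sup_over (fun y => Om y /\ cell n i j y) F)).
Proof.
  unfold upper_sum. rewrite ssum_fsum, Nat.mul_assoc.
  assert (E : forall i : nat,
    - INR N + INR i * / 2 ^ n = IZR (Z.of_nat i - Z.of_nat (N * 2 ^ n)) * mesh n).
  { intros i. rewrite minus_IZR, Rmult_minus_distr_r, mesh_box_Z.
    rewrite <- INR_IZR_INZ. unfold mesh. ring. }
  assert (E' : forall i : nat,
    - INR N + INR (S i) * / 2 ^ n
    = (IZR (Z.of_nat i - Z.of_nat (N * 2 ^ n)) + 1) * mesh n).
  { intros i. rewrite Rmult_plus_distr_r, <- E, S_INR. unfold mesh. ring. }
  apply fsum_ext; intros i _. rewrite ssum_fsum, Nat.mul_assoc.
  apply fsum_ext; intros j _. fold (mesh n). f_equal.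
  apply Rsup_ext. intros s. unfold cell.
  rewrite <- !E, <- !E'.
  split; intros [y H]; exists y; unfold mesh in *; tauto.
Qed.

Section Integral.
Variables (Om : pt -> Prop) (F : pt -> R) (M C : R).
Hypothesis HF : forall z, 0 <= F z <= M.
Hypothesis HFC : elip C F.

Lemma sup_over_ge0 (A : pt -> Prop) : 0 <= sup_over A F.
Proof. apply Rsup_ge0. intros s [y [_ ->]]. apply HF. Qed.

Lemma sup_over_ub (A : pt -> Prop) (y : pt) : A y -> F y <= sup_over A F.
Proof.
  intros Hy. apply Rsup_ub.
  - exists M. intros s [w [_ ->]]. apply HF.
  - exists y. tauto.
Qed.

Lemma upper_sum_ge0 (n N : nat) : 0 <= upper_sum Om F n N.
Proof.
  rewrite upper_sum_ssum. pose proof (mesh_pos n).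
  rewrite <- (ssum_0 (N * 2 ^ n) (fun _ => 0)) by reflexivity.
  apply ssum_le; intros i _.
  rewrite <- (ssum_0 (N * 2 ^ n) (fun _ => 0)) by reflexivity.
  apply ssum_le; intros j _.
  apply Rmult_le_pos; [nra|]. apply sup_over_ge0.
Qed.

Lemma integral2_le_upper_sum (n N : nat) :
  in_box N Om -> integral2 Om F <= upper_sum Om F n N.
Proof.
  intros HN. apply Rinf_lb.
  - intros s [n' [N' [_ ->]]]. apply upper_sum_ge0.
  - exists n, N. split; [exact HN|reflexivity].
Qed.

Lemma integral2_approx (e : R) : (exists N, in_box N Om) -> 0 < e ->
  exists n N, in_box N Om /\ upper_sum Om F n N <= integral2 Om F + e.
Proof.
  intros [N HN] He. destruct (Rinf_approx
    (fun s => exists n N : nat,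
          (forall z, Om z -> - INR N <= fst z <= INR N /\
                             - INR N <= snd z <= INR N) /\
          s = upper_sum Om F n N) e) as [s [[n [N' [HN' ->]]] Hs]].
  - exists (upper_sum Om F 0 N), 0%nat, N. split; [exact HN|reflexivity].
  - exact He.
  - exists n, N'. split; assumption.
Qed.

(** On each cell, [F] on [Om] is at most [f], which differs from its value at the lower left corner
    by at most [2 * D * mesh n]. Over the whole box the error is [8 * W^2 * D * mesh n]. *)
Lemma integral2_le_gridsum (f : pt -> R) (W : nat) (e : R) :
  in_box W Om -> lip f -> (forall z, 0 <= f z) -> (forall z, Om z -> F z <= f z) ->
  0 < e ->
  exists n0, forall n, (n0 <= n)%nat -> integral2 Om F <= gridsum n W f + e.
Proof.
  intros HW [D [HD Hf]] Hf0 HFf He.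
  assert (HW2 : 0 <= INR W) by apply pos_INR.
  destruct (mesh_small (e / (8 * INR W * INR W * D + 1))) as [n0 Hn0].
  { apply Rdiv_lt_0_compat; nra. }
  exists n0. intros n Hn. specialize (Hn0 n Hn). clear Hn.
  pose proof (mesh_pos n) as Hd. pose proof (mesh_box W n) as HL.
  eapply Rle_trans; [apply (integral2_le_upper_sum n W HW)|].
  rewrite upper_sum_ssum. set (d := mesh n) in *. set (L := (W * 2 ^ n)%nat) in *.
  assert (H : ssum L (fun i => ssum L (fun j =>
      d * d * sup_over (fun y => Om y /\ cell n i j y) F)) <=
    ssum L (fun i => ssum L (fun j => d * d * f (IZR i * d, IZR j * d))
                     + 2 * INR L * (d * d * (2 * D * d)))).
  { apply ssum_le; intros i _. rewrite <- ssum_const, <- ssum_plus.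
    apply ssum_le; intros j _. rewrite <- Rmult_plus_distr_l.
    apply Rmult_le_compat_l; [nra|]. apply Rsup_le.
    (* Non-negativity of [f] covers the cells that miss [Om], where the supremum takes its default
       value [0]. *)
    - specialize (Hf0 (IZR i * d, IZR j * d)). nra.
    - intros s [y [[Hy [Hc1 Hc2]] ->]]. fold d in Hc1, Hc2.
      specialize (HFf y Hy). specialize (Hf y (IZR i * d, IZR j * d)).
      simpl in Hf.
      rewrite (Rabs_right (fst y - _)), (Rabs_right (snd y - _)) in Hf by lra.
      assert (D * (fst y - IZR i * d + (snd y - IZR j * d)) <= 2 * D * d) by nra.
      revert Hf. unfold Rabs. destruct Rcase_abs; lra. }
  eapply Rle_trans; [exact H|]. rewrite ssum_plus, ssum_const.
  apply Rplus_le_compat; [apply Rle_refl|].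
  replace (2 * INR L * (2 * INR L * (d * d * (2 * D * d))))
    with (8 * (INR L * d) * (INR L * d) * D * d) by ring.
  rewrite HL.
  apply (Rmult_le_compat_r (8 * INR W * INR W * D + 1)) in Hn0; [|nra].
  replace (e / (8 * INR W * INR W * D + 1) * (8 * INR W * INR W * D + 1))
    with e in Hn0 by (field; nra).
  nra.
Qed.

Lemma sup_open_cell_outside (k N : nat) (i j : Z) :
  in_box N Om ->
  ~ (- Z.of_nat (N * 2 ^ k) <= i < Z.of_nat (N * 2 ^ k))%Z \/
  ~ (- Z.of_nat (N * 2 ^ k) <= j < Z.of_nat (N * 2 ^ k))%Z ->
  sup_over (fun y => Om y /\ open_cell k i j y) F = 0.
Proof.
  intros HN Hij. apply Rle_antisym; [|apply sup_over_ge0].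
  apply Rsup_le; [lra|]. intros s [y [[Hy [H1 H2]] _]]. exfalso.
  destruct (HN y Hy) as [B1 B2]. rewrite <- (mesh_box_Z N k) in B1, B2.
  pose proof (mesh_pos k) as Hd.
  assert (aux : forall q t, IZR q * mesh k < t < (IZR q + 1) * mesh k ->
    - (IZR (Z.of_nat (N * 2 ^ k)) * mesh k) <= t <=
      IZR (Z.of_nat (N * 2 ^ k)) * mesh k ->
    (- Z.of_nat (N * 2 ^ k) <= q < Z.of_nat (N * 2 ^ k))%Z).
  { intros q t Ht Bt. split.
    - apply Z.lt_succ_r. apply lt_IZR. rewrite succ_IZR, opp_IZR. nra.
    - apply lt_IZR. nra. }
  destruct Hij as [Hi|Hi]; apply Hi; eapply aux; eassumption.
Qed.

Lemma sup_open_cell_le_upper_sum (k N W : nat) : in_box N Om -> (N <= W)%nat ->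
  ssum (W * 2 ^ k) (fun i => ssum (W * 2 ^ k) (fun j =>
    mesh k * mesh k * sup_over (fun y => Om y /\ open_cell k i j y) F))
  <= upper_sum Om F k N.
Proof.
  intros HN HW. rewrite upper_sum_ssum. pose proof (mesh_pos k) as Hd.
  assert (HL : (N * 2 ^ k <= W * 2 ^ k)%nat) by (apply Nat.mul_le_mono_r; exact HW).
  rewrite (ssum_extend (N * 2 ^ k) (W * 2 ^ k)); [|exact HL|].
  - apply ssum_le; intros i _. rewrite (ssum_extend (N * 2 ^ k) (W * 2 ^ k)); [|exact HL|].
    + apply ssum_le; intros j _. apply Rmult_le_compat_l; [nra|].
      apply Rsup_le; [apply sup_over_ge0|]. intros s [y [[Hy [H1 H2]] ->]].
      apply sup_over_ub. split; [exact Hy|]. split; lra.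
    + intros j Hj. rewrite (sup_open_cell_outside k N) by tauto. ring.
  - intros i Hi. apply ssum_0. intros j _.
    rewrite (sup_open_cell_outside k N) by tauto. ring.
Qed.

(** Counts the ends of the block [0 .. P] from which the index [r] is less than [t] away. With [t]
    equal to [1 / m] in units of the fine mesh, it marks the points whose cutoff may see another
    coarse cell. *)
Definition near_end (P : nat) (t : R) (r : nat) : R :=
  (if Rlt_dec (INR r) t then 1 else 0) +
  (if Rlt_dec (INR P - t) (INR r) then 1 else 0).

Lemma fsum_near_end (P : nat) (t : R) : 0 <= t ->
  fsum P (near_end P t) <= 2 * t + 1.
Proof.
  intros Ht. unfold near_end. rewrite fsum_plus.
  pose proof (fsum_count_lt P t Ht). pose proof (fsum_count_gt P t Ht). lra.
Qed.

(* A grid point not close to the boundary of its coarse cell sees only the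
   part of [Om] lying in that same cell. *)
Lemma cutoff_grid_point (k p : nat) (m : R) (q1 q2 : Z) (r1 r2 : nat) :
  0 < m ->
  let P := (2 ^ p)%nat in let d := mesh (k + p) in let t := / m / d in
  let z := (IZR (q1 * Z.of_nat P + Z.of_nat r1) * d,
            IZR (q2 * Z.of_nat P + Z.of_nat r2) * d) in
  cutoff Om m z * F z <=
    sup_over (fun y => Om y /\ open_cell k q1 q2 y) F + C / m
    + M * near_end P t r1 + M * near_end P t r2.
Proof.
  intros Hm P d t z.
  pose proof (mesh_pos (k + p)) as Hd. fold d in Hd.
  pose proof (mesh_add k p) as Hdk. fold P d in Hdk.
  assert (HM : 0 <= M) by (destruct (HF z); lra).
  assert (HC : 0 <= C / m).
  { apply Rmult_le_pos; [apply HFC|]. left; apply Rinv_0_lt_compat, Hm. }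
  pose proof (sup_over_ge0 (fun y => Om y /\ open_cell k q1 q2 y)) as HS.
  pose proof (cutoff_01 Om m z Hm) as Hc. pose proof (HF z) as HFz.
  assert (Htd : t * d = / m) by (unfold t; field; lra).
  assert (Hle : cutoff Om m z * F z <= F z) by nra.
  unfold near_end.
  (* If either index is near an end, a term [M] on the right already dominates [F z]; only the case
     with both indices away from the ends survives [nra]. *)
  destruct (Rlt_dec (INR r1) t) as [A1|A1]; destruct (Rlt_dec _ (INR r1)) as [A2|A2];
  destruct (Rlt_dec (INR r2) t) as [A3|A3]; destruct (Rlt_dec _ (INR r2)) as [A4|A4];
  try nra.
  (* Either some point of [Om] is within [/ m] of [z], hence in the same open cell, and [F] changes
     by at most [C / m] between them, or the cutoff vanishes at [z]. *)
  destruct (classic (exists y, Om y /\ m * edist z y < 1)) as [[y [Hy Hyz]]|Hno].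
  - assert (He : edist z y < / m).
    { apply (Rmult_lt_reg_l m); [exact Hm|]. rewrite Rinv_r by lra. exact Hyz. }
    assert (Hcell : open_cell k q1 q2 y).
    { pose proof (edist_fst z y) as E1. pose proof (edist_snd z y) as E2.
      rewrite edist_sym in E1, E2.
      unfold z in E1, E2; simpl in E1, E2. fold z in E1, E2.
      rewrite edist_sym in E1, E2.
      rewrite plus_IZR, mult_IZR, <- !INR_IZR_INZ in E1, E2.
      replace ((IZR q1 * INR P + INR r1) * d)
        with (IZR q1 * mesh k + INR r1 * d) in E1 by (rewrite <- Hdk; ring).
      replace ((IZR q2 * INR P + INR r2) * d)
        with (IZR q2 * mesh k + INR r2 * d) in E2 by (rewrite <- Hdk; ring).
      apply Rnot_lt_le in A1, A2, A3, A4.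
      apply (Rmult_le_compat_r d) in A1, A2, A3, A4; try lra.
      rewrite Rmult_minus_distr_r, Hdk in A2, A4.
      unfold open_cell.
      revert E1 E2. unfold Rabs. repeat destruct Rcase_abs; lra. }
    pose proof (sup_over_ub (fun w => Om w /\ open_cell k q1 q2 w) y (conj Hy Hcell)).
    pose proof (elip_le C F z y HFC).
    assert (C * edist z y <= C / m).
    { apply Rmult_le_compat_l; [apply HFC|lra]. }
    lra.
  - rewrite (cutoff_far Om m z Hm); [lra|].
    intros y Hy. apply Rnot_lt_le. intros Hlt. apply Hno. exists y. tauto.
Qed.

(** The pointwise bound summed over all blocks. The term [C / m] is multiplied by the area
    [4 * W^2]. The marked indices number at most [2 * t + 1] per block and direction; relative to
    [P] indices this gives the terms in [2 ^ k / m] and, since [/ P = 2 ^ k * mesh (k + p)], in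
    [2 ^ k * mesh (k + p)]. *)
Lemma gridsum_cutoff_block (k p W : nat) (m : R) : 0 < m ->
  gridsum (k + p) W (fun z => cutoff Om m z * F z) <=
  ssum (W * 2 ^ k) (fun i => ssum (W * 2 ^ k) (fun j =>
    mesh k * mesh k * sup_over (fun y => Om y /\ open_cell k i j y) F))
  + (4 * INR W * INR W * C + 16 * INR W * INR W * M * 2 ^ k) / m
  + 8 * INR W * INR W * M * 2 ^ k * mesh (k + p).
Proof.
  intros Hm. pose proof (mesh_pos (k + p)) as Hd.
  pose proof (mesh_add k p) as Hdk.
  pose proof (mesh_box W k) as HL.
  pose proof (cutoff_grid_point k p m) as HG. cbv zeta in HG.
  unfold gridsum. rewrite Nat.pow_add_r, Nat.mul_assoc.
  set (d := mesh (k + p)) in *. set (P := (2 ^ p)%nat) in *.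
  set (Lk := (W * 2 ^ k)%nat) in *. set (t := / m / d) in *.
  assert (HM : 0 <= M) by (destruct (HF (0, 0)); lra).
  assert (Ht : 0 <= t).
  { unfold t. apply Rmult_le_pos; left; apply Rinv_0_lt_compat; assumption. }
  pose proof (fsum_near_end P t Ht) as Hb.
  set (b := fsum P (near_end P t)) in *.
  set (c := fun i j => sup_over (fun y => Om y /\ open_cell k i j y) F) in *.
  assert (HP : 0 <= INR P) by apply pos_INR.
  assert (HLk : 0 <= INR Lk) by apply pos_INR.
  assert (H1 : forall q1 r1,
    ssum (Lk * P) (fun j => d * d * (cutoff Om m (IZR (q1 * Z.of_nat P + Z.of_nat r1) * d, IZR j * d)
       * F (IZR (q1 * Z.of_nat P + Z.of_nat r1) * d, IZR j * d))) <=
    d * d * (INR P * ssum Lk (c q1)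
       + 2 * INR Lk * (INR P * (C / m) + M * b))
       + d * d * (2 * INR Lk * INR P * M) * near_end P t r1).
  { intros q1 r1. rewrite ssum_block.
    apply (Rle_trans _ (ssum Lk (fun q2 => d * d * (INR P * c q1 q2)
      + d * d * (INR P * (C / m) + INR P * (M * near_end P t r1) + M * b)))).
    - apply ssum_le; intros q2 _.
      apply (Rle_trans _ (fsum P (fun r2 =>
        d * d * (c q1 q2 + C / m + M * near_end P t r1)
        + d * d * M * near_end P t r2))).
      + apply fsum_le; intros r2 _. specialize (HG q1 q2 r1 r2 Hm).
        fold (c q1 q2) in HG.
        eapply Rle_trans; [apply Rmult_le_compat_l; [nra|exact HG]|]. right; ring.
      + rewrite fsum_plus, fsum_const, fsum_scal. fold b. right; ring.
    - rewrite ssum_plus, ssum_const, ssum_scal, ssum_scal. right; ring. }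
  rewrite ssum_block.
  apply (Rle_trans _ (ssum Lk (fun q1 =>
    d * d * (INR P * INR P) * ssum Lk (c q1)
    + d * d * (2 * INR Lk * (INR P * INR P * (C / m) + 2 * INR P * M * b))))).
  - apply ssum_le; intros q1 _.
    eapply Rle_trans; [apply fsum_le; intros r1 _; apply H1|].
    rewrite fsum_plus, fsum_const, fsum_scal. fold b. right; ring.
  - rewrite ssum_plus, ssum_const, ssum_scal.
    replace (d * d * (INR P * INR P)) with (mesh k * mesh k) by (rewrite <- Hdk; ring).
    rewrite Rplus_assoc. apply Rplus_le_compat.
    + right. rewrite <- ssum_scal. apply ssum_ext; intros i _.
      rewrite <- ssum_scal. reflexivity.
    + assert (HP1 : 0 < INR P) by (unfold P; rewrite INR_pow2; apply pow_lt; lra).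
      assert (Hk2 : INR P * d * 2 ^ k = 1).
      { rewrite Hdk. unfold mesh. field. apply pow_nonzero; lra. }
      assert (HW : INR Lk * (INR P * d) = INR W) by (rewrite Hdk; exact HL).
      replace (2 * INR Lk * (d * d * (2 * INR Lk * (INR P * INR P * (C / m) + 2 * INR P * M * b))))
        with (4 * (INR Lk * (INR P * d)) * (INR Lk * (INR P * d)) * C / m
              + 8 * INR Lk * INR Lk * d * d * INR P * M * b) by (field; lra).
      rewrite HW.
      assert (Hb2 : 8 * INR Lk * INR Lk * d * d * INR P * M * b <=
        8 * INR Lk * INR Lk * d * d * INR P * M * (2 * t + 1)).
      { apply Rmult_le_compat_l; [|exact Hb].
        repeat apply Rmult_le_pos; lra. }
      replace (8 * INR Lk * INR Lk * d * d * INR P * M * (2 * t + 1))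
        with (8 * (INR Lk * (INR P * d)) * (INR Lk * (INR P * d)) * M
              * (2 / m + d) * (/ (INR P * d))) in Hb2 by (unfold t; field; lra).
      rewrite HW in Hb2.
      replace (/ (INR P * d)) with (2 ^ k) in Hb2
        by (apply (Rmult_eq_reg_l (INR P * d)); [rewrite Rinv_r; nra|nra]).
      eapply Rle_trans; [apply Rplus_le_compat_l, Hb2|]. right. field. lra.
Qed.

(** The counterpart of [integral2_le_gridsum]: steep cutoffs do not overshoot an upper sum by more
    than [e]. The steepness is chosen after the coarse mesh [k], and the fine mesh after the
    steepness. The box [S N] contains the support of the cutoffs. *)
Lemma gridsum_cutoff_le (k N : nat) (e : R) : in_box N Om -> 0 < e ->
  exists m0, 1 <= m0 /\ forall m, m0 <= m -> exists n0, forall n, (n0 <= n)%nat ->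
    gridsum n (S N) (fun z => cutoff Om m z * F z) <= upper_sum Om F k N + e.
Proof.
  intros HN He. set (W := S N).
  assert (HM : 0 <= M) by (destruct (HF (0, 0)); lra).
  assert (HC : 0 <= C) by apply HFC.
  assert (HW : 0 <= INR W) by apply pos_INR.
  assert (H2k : 0 < 2 ^ k) by (apply pow_lt; lra).
  assert (HWW : 0 <= INR W * INR W) by nra.
  assert (HMk : 0 <= M * 2 ^ k) by nra.
  set (A := 4 * INR W * INR W * C + 16 * INR W * INR W * M * 2 ^ k).
  set (B := 8 * INR W * INR W * M * 2 ^ k).
  assert (HA : 0 <= A).
  { unfold A. replace (4 * INR W * INR W * C + 16 * INR W * INR W * M * 2 ^ k)
      with (4 * ((INR W * INR W) * C) + 16 * ((INR W * INR W) * (M * 2 ^ k))) by ring.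
    nra. }
  assert (HB : 0 <= B).
  { unfold B. replace (8 * INR W * INR W * M * 2 ^ k)
      with (8 * ((INR W * INR W) * (M * 2 ^ k))) by ring. nra. }
  assert (HAe : 0 <= 2 * A / e).
  { apply Rmult_le_pos; [lra|]. left; apply Rinv_0_lt_compat, He. }
  (* This makes [A / m <= e / 2]; the other half of [e] is left for the term in the fine mesh. *)
  exists (1 + 2 * A / e). split; [lra|].
  intros m Hm. assert (Hm1 : 0 < m) by lra.
  destruct (mesh_small (e / (2 * (B + 1)))) as [n0 Hn0].
  { apply Rdiv_lt_0_compat; lra. }
  exists (max n0 k). intros n Hn. specialize (Hn0 n ltac:(lia)).
  replace n with (k + (n - k))%nat in * by lia.
  eapply Rle_trans; [apply gridsum_cutoff_block, Hm1|].
  fold A B.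
  pose proof (sup_open_cell_le_upper_sum k N W HN ltac:(lia)) as HU.
  assert (H1 : A / m <= e / 2).
  { apply (Rmult_le_reg_r m); [exact Hm1|].
    replace (A / m * m) with A by (field; lra).
    assert (e / 2 * (2 * A / e) = A) by (field; lra). nra. }
  assert (H2 : B * mesh (k + (n - k)) <= e / 2).
  { apply (Rmult_le_compat_l (B + 1)) in Hn0; [|lra].
    replace ((B + 1) * (e / (2 * (B + 1)))) with (e / 2) in Hn0 by (field; lra).
    pose proof (mesh_pos (k + (n - k))). nra. }
  lra.
Qed.
End Integral.

(** * Folding and solid angle centers *)

Lemma gridsum_extend (n W W' : nat) (f : pt -> R) :
  (W <= W')%nat -> vanish (INR W) f -> gridsum n W' f = gridsum n W f.
Proof.
  intros HW Hv. unfold gridsum.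
  assert (HL : (W * 2 ^ n <= W' * 2 ^ n)%nat) by (apply Nat.mul_le_mono_r; exact HW).
  pose proof (mesh_pos n) as Hd. rewrite <- (mesh_box_Z W n) in Hv.
  set (L := (W * 2 ^ n)%nat) in *.
  assert (Hout : forall i, ~ (- Z.of_nat L <= i < Z.of_nat L)%Z ->
    IZR (Z.of_nat L) * mesh n <= Rabs (IZR i * mesh n)).
  { intros i Hi. rewrite Rabs_mult, (Rabs_right (mesh n)), <- abs_IZR by lra.
    apply Rmult_le_compat_r; [lra|]. apply IZR_le. lia. }
  rewrite (ssum_extend L); [|exact HL|].
  - apply ssum_ext; intros i _. apply ssum_extend; [exact HL|].
    intros j Hj. rewrite Hv; [ring|]. right. apply Hout, Hj.
  - intros i Hi. apply ssum_0. intros j _. rewrite Hv; [ring|].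
    left. apply Hout, Hi.
Qed.

(** A primitive of the indicator of [[a, a + s]]: its increment over a mesh interval is the length
    of the overlap with [[a, a + s]], and the increments telescope to [s]. *)
Definition ramp (a s x : R) : R := Rmax 0 (Rmin s (x - a)).

Lemma ramp_step (a s x d : R) : 0 <= s -> 0 < d ->
  0 <= ramp a s (x + d) - ramp a s x <= d /\
  (x < a - d \/ a + s < x -> ramp a s (x + d) - ramp a s x = 0).
Proof.
  intros Hs Hd. unfold ramp, Rmax, Rmin. repeat destruct Rle_dec; lra.
Qed.

Lemma ramp_sum (n W : nat) (a s : R) : 0 <= s -> - INR W <= a -> a + s <= INR W ->
  ssum (W * 2 ^ n) (fun i =>
    ramp a s (IZR i * mesh n + mesh n) - ramp a s (IZR i * mesh n)) = s.
Proof.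
  intros Hs H1 H2.
  pose proof (ssum_succ (W * 2 ^ n) (fun i => ramp a s (IZR i * mesh n))) as H.
  cbv beta in H. rewrite opp_IZR, Ropp_mult_distr_l_reverse, mesh_box_Z in H.
  rewrite (ssum_ext _ _ (fun i => ramp a s (IZR (i + 1) * mesh n)
                                  + (-1) * ramp a s (IZR i * mesh n))).
  - rewrite ssum_plus, ssum_scal, H. unfold ramp, Rmax, Rmin.
    repeat destruct Rle_dec; lra.
  - intros i _. rewrite plus_IZR, Rmult_plus_distr_r, Rmult_1_l. ring.
Qed.

Lemma gridsum_ge_square (n W : nat) (f : pt -> R) (w : pt) (s e : R) :
  0 < s -> 0 <= e -> (forall z, 0 <= f z) ->
  (forall z, Rabs (fst z - fst w) <= s -> Rabs (snd z - snd w) <= s -> e <= f z) ->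
  Rabs (fst w) + s <= INR W -> Rabs (snd w) + s <= INR W -> mesh n <= s / 2 ->
  e * (s * s) <= gridsum n W f.
Proof.
  intros Hs He Hf0 Hf HW1 HW2 Hn. pose proof (mesh_pos n) as Hd.
  assert (B1 : - INR W <= fst w - s / 2 /\ fst w - s / 2 + s <= INR W).
  { revert HW1. unfold Rabs. destruct Rcase_abs; lra. }
  assert (B2 : - INR W <= snd w - s / 2 /\ snd w - s / 2 + s <= INR W).
  { revert HW2. unfold Rabs. destruct Rcase_abs; lra. }
  (* The weights [r1 i * r2 j] are the areas of overlap of the cells with the square of side [s]
     centred at [w]. As [mesh n <= s / 2], a non-zero weight forces the corner of the cell to be
     within [s] of [w] in each coordinate. *)
  set (r1 := fun i => ramp (fst w - s / 2) s (IZR i * mesh n + mesh n)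
                      - ramp (fst w - s / 2) s (IZR i * mesh n)).
  set (r2 := fun i => ramp (snd w - s / 2) s (IZR i * mesh n + mesh n)
                      - ramp (snd w - s / 2) s (IZR i * mesh n)).
  assert (S1 : ssum (W * 2 ^ n) r1 = s) by (apply ramp_sum; lra).
  assert (S2 : ssum (W * 2 ^ n) r2 = s) by (apply ramp_sum; lra).
  replace (e * (s * s)) with
    (ssum (W * 2 ^ n) (fun i => ssum (W * 2 ^ n) (fun j => (e * r1 i) * r2 j))).
  - apply ssum_le; intros i _. apply ssum_le; intros j _.
    destruct (ramp_step (fst w - s / 2) s (IZR i * mesh n) (mesh n)) as [P1 Q1];
      try lra. fold (r1 i) in P1, Q1.
    destruct (ramp_step (snd w - s / 2) s (IZR j * mesh n) (mesh n)) as [P2 Q2];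
      try lra. fold (r2 j) in P2, Q2.
    specialize (Hf0 (IZR i * mesh n, IZR j * mesh n)).
    assert (H0 : 0 <= mesh n * mesh n * f (IZR i * mesh n, IZR j * mesh n)).
    { apply Rmult_le_pos; [nra|exact Hf0]. }
    destruct (Rle_lt_dec (Rabs (IZR i * mesh n - fst w)) s) as [A1|A1].
    + destruct (Rle_lt_dec (Rabs (IZR j * mesh n - snd w)) s) as [A2|A2].
      * specialize (Hf (IZR i * mesh n, IZR j * mesh n) A1 A2).
        assert (r1 i * r2 j <= mesh n * mesh n) by nra.
        assert (0 <= r1 i * r2 j) by nra. nra.
      * rewrite Q2; [lra|]. revert A2. unfold Rabs. destruct Rcase_abs; lra.
    + rewrite Q1; [lra|]. revert A1. unfold Rabs. destruct Rcase_abs; lra.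
  - rewrite (ssum_ext _ _ (fun i => (e * s) * r1 i)).
    + rewrite ssum_scal, S1. ring.
    + intros i _. rewrite ssum_scal, S2. ring.
Qed.

(** * The solid angle kernel: monotonicity, bounds and Lipschitz constant *)

Definition kern (h : R) (x y : pt) : R := h / Rpower (dist2 y x + h ^ 2) (3 / 2).

(** The distance in space from [y] to the point at height [h] above [x]. It turns the power [3 / 2]
    into a cube. *)
Definition slant (h : R) (x y : pt) : R := sqrt (dist2 y x + h ^ 2).

Section Kernel.
Variable h : R.
Hypothesis Hh : 0 < h.

Lemma slant_sq (x y : pt) : slant h x y * slant h x y = dist2 y x + h ^ 2.
Proof. apply sqrt_sqrt. pose proof (dist2_ge0 y x). nra. Qed.

Lemma slant_ge (x y : pt) : h <= slant h x y.
Proof.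
  pose proof (slant_sq x y). pose proof (dist2_ge0 y x).
  assert (0 <= slant h x y) by apply sqrt_pos. nra.
Qed.

Lemma kern_slant (x y : pt) : kern h x y = h / (slant h x y) ^ 3.
Proof.
  pose proof (slant_ge x y) as H. unfold kern. rewrite <- slant_sq.
  f_equal. replace (slant h x y * slant h x y) with (Rpower (slant h x y) 2).
  - rewrite Rpower_mult. replace (2 * (3 / 2)) with (INR 3) by (simpl; lra).
    apply Rpower_pow. lra.
  - replace 2 with (INR 2) by (simpl; lra). rewrite Rpower_pow by lra. ring.
Qed.

Lemma kern_lt (x y x' y' : pt) :
  dist2 y x < dist2 y' x' -> kern h x' y' < kern h x y.
Proof.
  intros Hd. rewrite !kern_slant.
  pose proof (slant_ge x y). pose proof (slant_ge x' y').
  assert (slant h x y < slant h x' y').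
  { pose proof (slant_sq x y). pose proof (slant_sq x' y'). nra. }
  apply Rmult_lt_compat_l; [exact Hh|]. apply Rinv_0_lt_contravar.
  - apply pow_lt. lra.
  - set (a := slant h x y) in *. set (b := slant h x' y') in *.
    assert (0 < (b - a) * (a * a + a * b + b * b)) by (apply Rmult_lt_0_compat; nra).
    nra.
Qed.

Lemma kern_ext (x y x' y' : pt) :
  dist2 y x = dist2 y' x' -> kern h x y = kern h x' y'.
Proof. unfold kern. intros ->. reflexivity. Qed.

Lemma kern_le (x y x' y' : pt) :
  dist2 y x <= dist2 y' x' -> kern h x' y' <= kern h x y.
Proof.
  intros [H|H]; [left; apply kern_lt, H|]. right. apply kern_ext. symmetry; exact H.
Qed.

Lemma kern_bounds (x y : pt) : 0 <= kern h x y <= / h ^ 2.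
Proof.
  split.
  - unfold kern. apply Rmult_le_pos; [lra|].
    left. apply Rinv_0_lt_compat. apply exp_pos.
  - rewrite kern_slant. replace (/ h ^ 2) with (h * / h ^ 3) by (field; lra).
    apply Rmult_le_compat_l; [lra|]. apply Rinv_le_contravar.
    + apply pow_lt, Hh.
    + apply pow_incr. pose proof (slant_ge x y). lra.
Qed.

(** The squares of the slants and of the planar distances to [x] have the same difference, and each
    slant is at least the planar distance; factoring both differences leaves the triangle
    inequality. *)
Lemma slant_elip (x y z : pt) : Rabs (slant h x y - slant h x z) <= edist y z.
Proof.
  pose proof (slant_ge x y). pose proof (slant_ge x z).
  pose proof (slant_sq x y) as E1. pose proof (slant_sq x z) as E2.
  rewrite <- edist_sq in E1, E2.
  pose proof (edist_ge0 y x). pose proof (edist_ge0 z x).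
  pose proof (edist_triangle y z x) as T1. pose proof (edist_triangle z y x) as T2.
  rewrite (edist_sym z y) in T2.
  assert (edist y x <= slant h x y) by nra.
  assert (edist z x <= slant h x z) by nra.
  assert (Hm : (slant h x y - slant h x z) * (slant h x y + slant h x z) =
          (edist y x - edist z x) * (edist y x + edist z x)) by nra.
  pose proof (edist_ge0 y z).
  apply Rabs_le. split; apply Rnot_lt_le; intros Hlt; nra.
Qed.

Lemma kern_elip (x : pt) : elip (3 / h ^ 3) (kern h x).
Proof.
  assert (Hh3 : 0 < h ^ 3) by (apply pow_lt, Hh).
  assert (HC : 0 <= 3 / h ^ 3).
  { apply Rmult_le_pos; [lra|]. left; apply Rinv_0_lt_compat, Hh3. }
  apply elip_of_le; [exact HC|].
  intros y z. rewrite !kern_slant.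
  pose proof (slant_ge x y) as Hs. pose proof (slant_ge x z) as Ht.
  assert (Hst : slant h x z - slant h x y <= edist y z).
  { pose proof (slant_elip x y z) as H. revert H. unfold Rabs. destruct Rcase_abs; lra. }
  pose proof (edist_ge0 y z) as He.
  set (s := slant h x y) in *. set (t := slant h x z) in *.
  set (e := edist y z) in *. clearbody s t e.
  assert (Is : 0 < / s <= / h).
  { split; [apply Rinv_0_lt_compat; lra|apply Rinv_le_contravar; lra]. }
  assert (It : 0 < / t <= / h).
  { split; [apply Rinv_0_lt_compat; lra|apply Rinv_le_contravar; lra]. }
  (* After factoring out [t - s], each of the three products of reciprocals is at most [(/ h) ^ 4],
     so the constant is [h * 3 * (/ h) ^ 4 = 3 / h ^ 3]. *)
  assert (Hd : h / s ^ 3 - h / t ^ 3 =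
    h * (t - s) * (/ s * / t * (/ s * / s + / s * / t + / t * / t))) by (field; lra).
  assert (HK : 0 <= / s * / t * (/ s * / s + / s * / t + / t * / t) <= 3 * (/ h) ^ 4).
  { set (a := / s) in *. set (b := / t) in *. set (g := / h) in *. clearbody a b g.
    assert (0 <= a * b <= g * g) by nra.
    assert (0 <= a * a <= g * g) by nra.
    assert (0 <= b * b <= g * g) by nra.
    split; [nra|]. replace (3 * g ^ 4) with ((g * g) * (g * g + g * g + g * g)) by ring.
    apply Rmult_le_compat; nra. }
  assert (Hf : 3 / h ^ 3 * e = h * e * (3 * (/ h) ^ 4)) by (field; lra).
  rewrite Hf.
  set (K := / s * / t * (/ s * / s + / s * / t + / t * / t)) in *.
  assert (h * (t - s) * K <= h * e * K).
  { apply Rmult_le_compat_r; [apply HK|]. apply Rmult_le_compat_l; lra. }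
  assert (h * e * K <= h * e * (3 * (/ h) ^ 4)).
  { apply Rmult_le_compat_l; [nra|apply HK]. }
  lra.
Qed.
End Kernel.

(** * Reflections, and the gain in solid angle from reflecting a viewpoint *)

Section Reflection.
Variables (v : pt) (c : R).
Hypothesis Hv : unit_vec v.

Lemma dot_refl (z : pt) : dot (refl v c z) v = 2 * c - dot z v.
Proof.
  destruct v as [p q]. unfold unit_vec in Hv. simpl fst in Hv; simpl snd in Hv.
  assert (H : p * p = 1 - q * q) by nra.
  unfold refl, dot; simpl. ring [H].
Qed.

Lemma reflK (z : pt) : refl v c (refl v c z) = z.
Proof.
  unfold refl at 1. rewrite dot_refl. destruct z as [a b].
  unfold refl; simpl fst; simpl snd. f_equal; ring.
Qed.

Lemma dist2_refl (z w : pt) : dist2 (refl v c z) (refl v c w) = dist2 z w.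
Proof.
  destruct v as [p q]. unfold unit_vec in Hv. simpl fst in Hv; simpl snd in Hv.
  assert (H : p * p = 1 - q * q) by nra.
  unfold refl, dot, dist2; simpl. ring [H].
Qed.

Lemma dist2_refl_l (z w : pt) : dist2 (refl v c z) w = dist2 z (refl v c w).
Proof. rewrite <- (dist2_refl z), reflK. reflexivity. Qed.

Lemma edist_refl (z w : pt) : edist (refl v c z) (refl v c w) = edist z w.
Proof. unfold edist. rewrite dist2_refl. reflexivity. Qed.

Lemma edist_refl_l (z w : pt) : edist (refl v c z) w = edist z (refl v c w).
Proof. unfold edist. rewrite dist2_refl_l. reflexivity. Qed.

(** The source of every sign below: [z] is nearer to [x] than to its mirror image exactly when [x]
    and [z] lie strictly on the same side of the mirror. *)
Lemma dist2_refl_r (z x : pt) :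
  dist2 z (refl v c x) = dist2 z x + 4 * (dot x v - c) * (dot z v - c).
Proof.
  destruct v as [p q]. unfold unit_vec in Hv. simpl fst in Hv; simpl snd in Hv.
  assert (H : p * p = 1 - q * q) by nra.
  unfold refl, dot, dist2; simpl. ring [H].
Qed.

Lemma dot_edist (z w : pt) : Rabs (dot z v - dot w v) <= edist z w.
Proof.
  pose proof (edist_ge0 z w) as He. pose proof (edist_sq z w) as H.
  destruct v as [p q]. unfold unit_vec in Hv. simpl fst in Hv; simpl snd in Hv.
  unfold dist2 in H. unfold dot; simpl fst at 2 4; simpl snd at 2 4.
  set (a := fst z - fst w) in *. set (b := snd z - snd w) in *.
  replace (fst z * p + snd z * q - (fst w * p + snd w * q))
    with (a * p + b * q) by (unfold a, b; ring).
  (* The Cauchy-Schwarz inequality: by the identity of Lagrange the defect is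
     [(a * q - b * p)^2]. *)
  assert (Hsq : (a * p + b * q) * (a * p + b * q) <= edist z w * edist z w).
  { rewrite H. replace (a ^ 2 + b ^ 2) with ((a ^ 2 + b ^ 2) * (p ^ 2 + q ^ 2))
      by (rewrite Hv; ring).
    pose proof (pow2_ge_0 (a * q - b * p)). nra. }
  apply Rabs_le. split; nra.
Qed.

Variables (Om : pt -> Prop).
Hypothesis Hfold : refl_plus_in Om v c.

(** A point of [Om] on the plus side is matched by its reflection, which is in [Om] by folding. One
    on the minus side is matched by itself, being no farther from the reflection of [z] than from
    [z]. *)
Lemma cutoff_refl_le (m : R) (z : pt) :
  0 < m -> c <= dot z v -> cutoff Om m z <= cutoff Om m (refl v c z).
Proof.
  intros Hm Hz. apply cutoff_le; [exact Hm|]. intros y Hy.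
  destruct (Rle_lt_dec c (dot y v)) as [Hc|Hc].
  - exists (refl v c y). split; [apply Hfold; assumption|]. rewrite edist_refl. lra.
  - exists y. split; [exact Hy|]. rewrite edist_sym, (edist_sym z y).
    apply edist_le_of_dist2. rewrite dist2_refl_r. nra.
Qed.

(** Both factors are non-positive on the plus side and non-negative on the minus side. *)
Lemma folding_integrand_ge0 (h m : R) (x z : pt) :
  0 < h -> 0 < m -> c <= dot x v ->
  0 <= (cutoff Om m z - cutoff Om m (refl v c z))
       * (kern h (refl v c x) z - kern h x z).
Proof.
  intros Hh Hm Hx. destruct (Rle_lt_dec c (dot z v)) as [Hz|Hz].
  - pose proof (cutoff_refl_le m z Hm Hz).
    assert (kern h (refl v c x) z <= kern h x z).
    { apply kern_le; [exact Hh|]. rewrite dist2_refl_r. nra. }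
    nra.
  - assert (cutoff Om m (refl v c z) <= cutoff Om m z).
    { rewrite <- (reflK z) at 2. apply cutoff_refl_le; [exact Hm|].
      rewrite dot_refl. lra. }
    assert (kern h x z <= kern h (refl v c x) z).
    { apply kern_le; [exact Hh|]. rewrite dist2_refl_r. nra. }
    nra.
Qed.

(** The disc about [w] lies in [Om] but its mirror image misses [Om], so the integrand of
    [folding_integrand_ge0] is bounded below near [w]. The resulting gain [delta] must outweigh all
    discretisation errors. *)
Lemma solid_angle_lt_refl (h rho : R) (x w : pt) :
  0 < h -> (exists N, in_box N Om) -> c < dot x v -> dot w v < c -> 0 < rho ->
  (forall z, edist z w < rho -> Om z) ->
  (forall z, edist z (refl v c w) < rho -> ~ Om z) ->
  solid_angle Om h x < solid_angle Om h (refl v c x).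
Proof.
  intros Hh Hbox Hx Hw Hrho Hin Hout.
  set (x' := refl v c x).
  change (integral2 Om (kern h x) < integral2 Om (kern h x')).
  set (M := / h ^ 2). set (C := 3 / h ^ 3).
  assert (HF : forall z, 0 <= kern h x z <= M) by (intros z; apply kern_bounds, Hh).
  assert (HF' : forall z, 0 <= kern h x' z <= M) by (intros z; apply kern_bounds, Hh).
  assert (HL : elip C (kern h x)) by (apply kern_elip, Hh).
  assert (HL' : elip C (kern h x')) by (apply kern_elip, Hh).
  assert (HC : 0 <= C) by apply HL.
  set (g := kern h x' w - kern h x w).
  assert (Hg : 0 < g).
  { assert (kern h x w < kern h x' w); [|unfold g; lra].
    apply kern_lt; [exact Hh|]. unfold x'. rewrite dist2_refl_r. nra. }
  (* Within [s] of [w] in each coordinate the distance to [w] is at most [2 * s]. This is at most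
     [rho / 2], and the two kernels together change by at most [C * (4 * s) <= g / 2]. *)
  set (s := Rmin (rho / 4) (g / (8 * (C + 1)))).
  assert (Hs : 0 < s).
  { apply Rmin_glb_lt; [lra|]. apply Rdiv_lt_0_compat; lra. }
  assert (Hs1 : s <= rho / 4) by apply Rmin_l.
  assert (Hs2 : C * (4 * s) <= g / 2).
  { assert (s <= g / (8 * (C + 1))) as H by apply Rmin_r.
    apply (Rmult_le_compat_r (8 * (C + 1))) in H; [|lra].
    replace (g / (8 * (C + 1)) * (8 * (C + 1))) with g in H by (field; lra). nra. }
  set (delta := g / 2 * (s * s)).
  assert (Hdelta : 0 < delta) by (unfold delta; apply Rmult_lt_0_compat; nra).
  (* The six estimates below cost [8 * e = delta / 2] in the doubled comparison of the two solid
     angles, leaving a strict gain. *)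
  set (e := delta / 16). assert (He : 0 < e) by (unfold e; lra).
  destruct (integral2_approx Om (kern h x') e Hbox He) as [k [N [HN HU]]].
  destruct (gridsum_cutoff_le Om (kern h x') M C HF' HL' k N e HN He) as [m0 [Hm0 HG]].
  (* With [2 / rho <= m] the cutoff vanishes at points whose distance from [Om] is at least
     [rho / 2], in particular at the reflections of points near [w]. *)
  set (m := Rmax m0 (2 / rho)).
  assert (Hm0m : m0 <= m) by apply Rmax_l.
  assert (Hmrho : 2 / rho <= m) by apply Rmax_r.
  assert (Hm : 0 < m) by lra.
  set (f := fun z => cutoff Om m z * kern h x z).
  set (f' := fun z => cutoff Om m z * kern h x' z).
  assert (Hvan : forall F, vanish (INR (S N)) (fun z => cutoff Om m z * F z)).
  { intros F z Hz. rewrite (cutoff_vanish Om N m HN ltac:(lra)); [ring|].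
    rewrite S_INR in Hz. exact Hz. }
  assert (Hlip : forall F, (forall z, 0 <= F z <= M) -> elip C F ->
    lip (fun z => cutoff Om m z * F z)).
  { intros F H1 H2. apply (elip_lip (m * M + C)). apply elip_mult; try assumption.
    - apply cutoff_elip, Hm.
    - intros z. apply cutoff_01, Hm. }
  assert (Hf : lipc f) by (split; [apply Hlip; assumption|exists (INR (S N)); apply Hvan]).
  assert (Hf' : lipc f') by (split; [apply Hlip; assumption|exists (INR (S N)); apply Hvan]).
  destruct (approx_refl v c f Hv Hf) as [W1 HA1].
  destruct (approx_refl v c f' Hv Hf') as [W2 HA2].
  destruct (INR_unbounded (Rabs (fst w) + Rabs (snd w) + s)) as [W3 HW3].
  set (W := (W1 + W2 + W3 + S N)%nat).
  assert (HW3' : INR W3 <= INR W) by (apply le_INR; lia).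
  assert (HNW : INR N <= INR W) by (apply le_INR; lia).
  assert (HW : in_box W Om).
  { intros z Hz. specialize (HN z Hz). lra. }
  destruct (HG m Hm0m) as [n1 HG1].
  destruct (HA1 W ltac:(lia) e He) as [n2 HA1'].
  destruct (HA2 W ltac:(lia) e He) as [n3 HA2'].
  destruct (integral2_le_gridsum Om (kern h x) M HF f W e HW) as [n4 HI].
  { apply Hf. }
  { intros z. unfold f. apply Rmult_le_pos; [apply cutoff_01, Hm|apply HF]. }
  { intros z Hz. unfold f. rewrite cutoff_in by assumption. lra. }
  { exact He. }
  destruct (mesh_small (s / 2)) as [n5 Hn5]; [lra|].
  set (n := (n1 + n2 + n3 + n4 + n5)%nat).
  specialize (HG1 n ltac:(lia)). specialize (HA1' n ltac:(lia)).
  specialize (HA2' n ltac:(lia)). specialize (HI n ltac:(lia)).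
  specialize (Hn5 n ltac:(lia)).
  assert (HE : gridsum n W f' = gridsum n (S N) f').
  { apply gridsum_extend; [lia|apply Hvan]. }
  fold f' in HG1. rewrite <- HE in HG1.
  set (G := fun z => (cutoff Om m z - cutoff Om m (refl v c z))
                     * (kern h x' z - kern h x z)).
  (* Expanding the product gives four terms; the reflection exchanges the kernels centred at [x] and
     [x'], so the two negative terms are [f] and its reflection. *)
  assert (Hsum : gridsum n W G + (gridsum n W f + gridsum n W (fun z => f (refl v c z)))
     = gridsum n W f' + gridsum n W (fun z => f' (refl v c z))).
  { rewrite <- !gridsum_plus. apply gridsum_ext. intros z. unfold G, f, f'.
    rewrite (kern_ext h x (refl v c z) x' z) by apply dist2_refl_l.
    rewrite (kern_ext h x' (refl v c z) x z)
      by (unfold x'; rewrite dist2_refl; reflexivity).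
    ring. }
  assert (HGd : delta <= gridsum n W G).
  { pose proof (Rabs_pos (fst w)). pose proof (Rabs_pos (snd w)).
    apply (gridsum_ge_square n W G w s (g / 2)); try lra.
    - intros z. apply folding_integrand_ge0; try assumption. lra.
    - intros z Hz1 Hz2. pose proof (edist_le_l1 z w) as Hzw.
      unfold G. rewrite (cutoff_in Om m z Hm) by (apply Hin; lra).
      rewrite (cutoff_far Om m (refl v c z) Hm).
      + pose proof (elip_le C _ z w HL) as K1.
        pose proof (elip_le C _ w z HL') as K2. rewrite edist_sym in K2.
        assert (C * edist z w <= C * (2 * s)) by (apply Rmult_le_compat_l; lra).
        unfold g in *. lra.
      + intros y Hy. assert (Hfar : rho <= edist (refl v c w) y).
        { apply Rnot_lt_le. intros Hlt. rewrite edist_sym in Hlt.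
          exact (Hout y Hlt Hy). }
        pose proof (edist_triangle (refl v c w) (refl v c z) y) as Ht.
        rewrite edist_refl, (edist_sym w z) in Ht.
        assert (1 = 2 / rho * (rho / 2)) as -> by (field; lra).
        apply Rmult_le_compat; try lra.
        left; apply Rdiv_lt_0_compat; lra. }
  revert HA1' HA2'. unfold Rabs. unfold e in *.
  repeat destruct Rcase_abs; lra.
Qed.
End Reflection.

(** * Closedness and boundedness of compact sets *)

Lemma in_list_le (l : list nat) : exists N, forall i, In i l -> (i <= N)%nat.
Proof.
  exists (list_max l). intros i Hi.
  pose proof (proj1 (list_max_le l (list_max l)) (Nat.le_refl _)) as H.
  rewrite Forall_forall in H. apply H, Hi.
Qed.

(** [Om] is covered by the exteriors of the closed discs of radius [mesh n] about [u]. These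
    exteriors grow with [n], so a finite subcover amounts to a single one. *)
Lemma compact2_closed (Om : pt -> Prop) (u : pt) : compact2 Om -> ~ Om u ->
  exists rho, 0 < rho /\ forall z, edist z u < rho -> ~ Om z.
Proof.
  intros Hc Hu.
  destruct (Hc nat (fun n z => mesh n < edist z u)) as [l Hl].
  - intros n z Hz. exists (edist z u - mesh n). split; [lra|]. intros y Hy.
    apply edist_lt in Hy; [|lra]. pose proof (edist_triangle z y u).
    rewrite (edist_sym z y) in *. lra.
  - intros z Hz. assert (Hpos : 0 < edist z u).
    { destruct (edist_ge0 z u) as [H|H]; [exact H|]. exfalso. apply Hu.
      replace u with z; [exact Hz|].
      pose proof (edist_fst z u) as H1. pose proof (edist_snd z u) as H2.
      rewrite <- H in H1, H2. rewrite (surjective_pairing z), (surjective_pairing u).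
      revert H1 H2. unfold Rabs. repeat destruct Rcase_abs; intros; f_equal; lra. }
    destruct (mesh_small (edist z u / 2)) as [n0 Hn0]; [lra|].
    exists n0. specialize (Hn0 n0 (Nat.le_refl _)). lra.
  - destruct (in_list_le l) as [N HN]. exists (mesh N). split; [apply mesh_pos|].
    intros z Hz Hom. destruct (Hl z Hom) as [i [Hi Hiz]].
    pose proof (mesh_le i N (HN i Hi)). lra.
Qed.

Lemma compact2_bounded (Om : pt -> Prop) : compact2 Om ->
  exists N : nat, forall z, Om z -> edist z (0, 0) < INR N.
Proof.
  intros Hc. destruct (Hc nat (fun n z => edist z (0, 0) < INR n)) as [l Hl].
  - intros n z Hz. exists (INR n - edist z (0, 0)). split; [lra|]. intros y Hy.
    apply edist_lt in Hy; [|lra]. pose proof (edist_triangle y z (0, 0)). lra.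
  - intros z _. apply INR_unbounded.
  - destruct (in_list_le l) as [N HN]. exists N. intros z Hz.
    destruct (Hl z Hz) as [i [Hi Hiz]]. pose proof (le_INR _ _ (HN i Hi)). lra.
Qed.

Lemma compact2_in_box (Om : pt -> Prop) : compact2 Om -> exists N, in_box N Om.
Proof.
  intros Hc. destruct (compact2_bounded Om Hc) as [N HN]. exists N. intros z Hz.
  specialize (HN z Hz). pose proof (edist_fst z (0, 0)) as H1.
  pose proof (edist_snd z (0, 0)) as H2. simpl in H1, H2. revert H1 H2.
  unfold Rabs. repeat destruct Rcase_abs; lra.
Qed.

(** * Reflecting and translating the interior *)

Definition interior_pt (Om : pt -> Prop) (p : pt) : Prop :=
  exists r, 0 < r /\ forall w, edist w p < r -> Om w.

(** On the minus side the maximality of [x] is used; on the mirror [p] is fixed; on the plus side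
    folding suffices, once the disc is shrunk to stay on that side. *)
Lemma interior_refl (Om : pt -> Prop) (h : R) (x v p : pt) (c : R) :
  compact2 Om -> 0 < h -> is_solid_angle_center Om h x -> unit_vec v ->
  refl_plus_in Om v c -> c < dot x v ->
  interior_pt Om p -> interior_pt Om (refl v c p).
Proof.
  intros Hc Hh Hx Hv Hfold Hcx [r [Hr Hp]].
  destruct (Rtotal_order (dot p v) c) as [Hlt|[Heq|Hgt]].
  - exists (Rmin r (c - dot p v)). split; [apply Rmin_glb_lt; lra|].
    intros u Hu. apply NNPP. intros Hnu.
    pose proof (Rmin_l r (c - dot p v)). pose proof (Rmin_r r (c - dot p v)).
    destruct (compact2_closed Om u Hc Hnu) as [rho0 [Hrho0 Hout]].
    set (w := refl v c u).
    assert (Hwp : edist w p < Rmin r (c - dot p v)).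
    { unfold w. rewrite edist_refl_l by exact Hv. exact Hu. }
    (* The disc of radius [rho] about [w] stays in the disc about [p], and its mirror image about
       [u] misses [Om]: the configuration that contradicts maximality. *)
    set (rho := Rmin rho0 (r - edist w p)).
    assert (Hrho1 : rho <= rho0) by apply Rmin_l.
    assert (Hrho2 : rho <= r - edist w p) by apply Rmin_r.
    apply (Rlt_irrefl (solid_angle Om h x)).
    apply (Rlt_le_trans _ (solid_angle Om h (refl v c x))); [|apply Hx].
    apply (solid_angle_lt_refl v c Hv Om Hfold h rho x w); try assumption.
    + apply compact2_in_box, Hc.
    + pose proof (dot_edist v Hv w p) as Hd. revert Hd. unfold Rabs.
      destruct Rcase_abs; lra.
    + apply Rmin_glb_lt; lra.
    + intros z Hz. apply Hp. pose proof (edist_triangle z w p). lra.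
    + intros z Hz. apply Hout. unfold w in Hz. rewrite reflK in Hz by exact Hv. lra.
  - exists r. split; [exact Hr|]. unfold refl. rewrite Heq.
    intros w. replace (fst p - 2 * (c - c) * fst v) with (fst p) by ring.
    replace (snd p - 2 * (c - c) * snd v) with (snd p) by ring.
    rewrite <- surjective_pairing. apply Hp.
  - exists (Rmin r (dot p v - c)). split; [apply Rmin_glb_lt; lra|].
    intros w Hw. rewrite <- (edist_refl v c Hv), reflK in Hw by exact Hv.
    pose proof (Rmin_l r (dot p v - c)). pose proof (Rmin_r r (dot p v - c)).
    rewrite <- (reflK v c Hv w). apply Hfold; [apply Hp; lra|].
    pose proof (dot_edist v Hv (refl v c w) p) as Hd. revert Hd. unfold Rabs.
    destruct Rcase_abs; lra.
Qed.

(** If [x] lay beyond [b], two parallel mirrors would fit between [b] and [x]. Their composition is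
    a translation preserving the interior, and its iterates leave every disc. *)
Lemma center_dot_le (Om : pt -> Prop) (h : R) (x v : pt) (b : R) :
  compact2 Om -> nonempty_interior Om -> 0 < h -> is_solid_angle_center Om h x ->
  unit_vec v -> (forall c, b <= c -> refl_plus_in Om v c) -> dot x v <= b.
Proof.
  intros Hc [p0 [r [Hr Hp0]]] Hh Hx Hv Hb. apply Rnot_lt_le. intros Hlt.
  set (s := dot x v - b).
  assert (Hstep : forall k : nat,
    exists p, interior_pt Om p /\ dot p v = dot p0 v + INR k * s).
  { induction k as [|k [p [Hp Hd]]].
    - exists p0. split; [|simpl; ring]. exists r. split; [exact Hr|].
      intros w Hw. apply Hp0. apply edist_lt; assumption.
    (* The mirrors at [b] and [b + s / 2] both lie below [dot x v = b + s]; reflecting in the first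
       and then in the second raises [dot p v] by [s]. *)
    - exists (refl v (b + s / 2) (refl v b p)). split.
      + apply (interior_refl Om h x); try assumption.
        * apply Hb. unfold s; lra.
        * unfold s; lra.
        * apply (interior_refl Om h x); try assumption. apply Hb. lra.
      + rewrite !dot_refl by exact Hv. rewrite Hd, S_INR. field. }
  destruct (compact2_bounded Om Hc) as [N HN].
  assert (Hs : 0 < s) by (unfold s; lra).
  destruct (INR_unbounded ((INR N - dot p0 v) / s)) as [k Hk].
  destruct (Hstep k) as [p [[r' [Hr' Hp]] Hd]].
  specialize (HN p (Hp p ltac:(rewrite edist_refl0; exact Hr'))).
  pose proof (dot_edist v Hv p (0, 0)) as Hd2.
  replace (dot (0, 0) v) with 0 in Hd2 by (unfold dot; simpl; ring).
  apply (Rmult_lt_compat_r s) in Hk; [|exact Hs].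
  replace ((INR N - dot p0 v) / s * s) with (INR N - dot p0 v) in Hk by (field; lra).
  revert Hd2. unfold Rabs. destruct Rcase_abs; lra.
Qed.

(** Beyond a bound of [Om] there is nothing to fold. This makes the sets defining [uval] and [lval]
    non-empty, which rules out one cause of the default value of [Rsup]. *)
Lemma refl_plus_in_far (Om : pt -> Prop) (v : pt) : compact2 Om -> unit_vec v ->
  exists b, forall c, b <= c -> refl_plus_in Om v c.
Proof.
  intros Hc Hv. destruct (compact2_bounded Om Hc) as [N HN]. exists (INR N).
  intros c Hcb z Hz Hcz. exfalso. specialize (HN z Hz).
  pose proof (dot_edist v Hv z (0, 0)) as Hd.
  replace (dot (0, 0) v) with 0 in Hd by (unfold dot; simpl; ring).
  revert Hd. unfold Rabs. destruct Rcase_abs; lra.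
Qed.

(** * Reversal of the direction, and the conclusion *)

Definition vopp (v : pt) : pt := (- fst v, - snd v).

Lemma dot_vopp (z v : pt) : dot z (vopp v) = - dot z v.
Proof. unfold dot, vopp; simpl. ring. Qed.

Lemma unit_vopp (v : pt) : unit_vec v -> unit_vec (vopp v).
Proof. unfold unit_vec, vopp; simpl. intros H. lra. Qed.

Lemma refl_vopp (v : pt) (c : R) (z : pt) : refl (vopp v) (- c) z = refl v c z.
Proof.
  unfold refl. rewrite dot_vopp. unfold vopp; simpl. f_equal; ring.
Qed.

Lemma refl_minus_plus (Om : pt -> Prop) (v : pt) (c : R) :
  refl_minus_in Om v c <-> refl_plus_in Om (vopp v) (- c).
Proof.
  unfold refl_minus_in, refl_plus_in. split; intros H z Hz Hcz.
  - rewrite refl_vopp. apply H; [exact Hz|]. rewrite dot_vopp in Hcz. lra.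
  - rewrite <- refl_vopp. apply H; [exact Hz|]. rewrite dot_vopp. lra.
Qed.

Theorem theorem2p5 :
  forall (Om : pt -> Prop),
    compact2 Om -> nonempty_interior Om ->
    forall h : R, 0 < h ->
    forall x : pt, is_solid_angle_center Om h x -> uf Om x.
Proof.
  intros Om Hc Hi h Hh x Hx v Hv. split.
  - apply Rsup_le_nonempty.
    + destruct (refl_plus_in_far Om (vopp v) Hc (unit_vopp v Hv)) as [b Hb].
      exists (- b). intros c Hcb. apply refl_minus_plus, Hb. lra.
    (* A lower bound in the direction [v] is an upper bound in the direction [vopp v], with [b]
       replaced by [- b]. *)
    + intros b Hb.
      enough (dot x (vopp v) <= - b) by (rewrite dot_vopp in *; lra).
      apply (center_dot_le Om h); try assumption; [apply unit_vopp, Hv|].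
      intros c Hcb. rewrite <- (Ropp_involutive c). apply refl_minus_plus, Hb. lra.
  - apply Rinf_ge.
    + apply refl_plus_in_far; assumption.
    + intros b Hb. apply (center_dot_le Om h); assumption.
Qed.
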